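(* Let $p\ge 2$, let $F$ be a distribution on $\mathbb{R}^p$, let $X\sim F$, let $X_1,X_2,\ldots$ be independent random vectors with distribution $F$, let $\mathbb{X}_n=(X_1,\ldots,X_n)^T$, let $t\in\mathbb{R}^p$, and let $(t_n)_{n\in\mathbb{N}}$ be a sequence of random $p$-vectors (defined on the same probability space as the $X_i$). Suppose that (I) $E|t_n-t|^4=O(n^{-2})$ as $n\to\infty$, (II) $E|X-t|^{-3/2}<\infty$, (III) $E\left\{\frac{X-t}{|X-t|^2}\right\}=0$ and $E\left\{\frac{(X-t)^{(i)}(X-t)^{(j)}(X-t)^{(k)}}{|X-t|^4}\right\}=0$ for all $i,j,k=1,\ldots,p$, where $(X-t)^{(i)}$ denotes the $i$th component of $X-t$. Then $\sqrt{n}\,\mathrm{vec}\{S_n(\mathbb{X}_n,t_n)-S(F,t)\}\to N_{p^2}(0,W)$ in distribution, where $W=\mathrm{Var}(Z)$ with $Z=\mathrm{vec}\{s(X-t)s(X-t)^T\}$.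
   Context: $|\cdot|$ denotes the Euclidean norm on $\mathbb{R}^p$. The spatial sign of $x\in\mathbb{R}^p$ is $s(x)=x/|x|$ for $x\neq 0$ and $s(0)=0$. For $X\sim F$ and $t\in\mathbb{R}^p$, $S(F,t)=E\{s(X-t)s(X-t)^T\}$. For a (possibly random) $u\in\mathbb{R}^p$, $S_n(\mathbb{X}_n,u)=\frac1n\sum_{i=1}^n s(X_i-u)s(X_i-u)^T$. For a matrix $A\in\mathbb{R}^{m\times n}$, $\mathrm{vec}\,A$ is the $mn$-vector obtained by stacking the columns of $A$ from left to right underneath each other. $N_k(0,W)$ denotes the $k$-variate normal distribution with mean $0$ and covariance $W$. *)

(* Defs.v *)
From HB Require Import structures.
From mathcomp Require Import all_boot all_order all_algebra finmap.
From mathcomp Require Import all_classical all_reals all_analysis.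
Set Implicit Arguments. Unset Strict Implicit. Unset Printing Implicit Defensive.
Import Order.TTheory GRing.Theory Num.Theory.
Import numFieldNormedType.Exports.
Local Open Scope classical_set_scope.
Local Open Scope ring_scope.

Section Defs.
Variable R : realType.

Definition enorm k (v : 'rV[R]_k) : R := Num.sqrt (\sum_i v ord0 i ^+ 2).

(* spatial sign s(x) = x/|x|, s(0) = 0 (since 0^-1 = 0 in MathComp) *)
Definition ssign k (v : 'rV[R]_k) : 'rV[R]_k := (enorm v)^-1 *: v.

(* s(v) s(v)^T as a k x k matrix (v is a row vector, so s^T s) *)
Definition souter k (v : 'rV[R]_k) : 'M[R]_k := (ssign v)^T *m ssign v.

Definition dotp k (u v : 'rV[R]_k) : R := \sum_i u ord0 i * v ord0 i.

(* vec A : stacking the columns of A (column-major). mxvec stacks rows,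
   so vec A = mxvec A^T. *)
Definition vec m n (A : 'M[R]_(m, n)) : 'rV[R]_(n * m) := mxvec A^T.

(* Borel sigma-algebra on R^k: generated by the coordinate projections *)
Definition coord_sets k : set (set 'rV[R]_k) :=
  fun S => exists (i : 'I_k) (A : set R), measurable A /\
             S = (fun v : 'rV[R]_k => v ord0 i) @^-1` A.

End Defs.

Notation vecR R k := (g_sigma_algebraType (@coord_sets R k)).

Section Defs2.
Variable R : realType.

Definition iid_with k d (T : measurableType d) (P : probability T R)
  (X : nat -> T -> vecR R k) (F : probability (vecR R k) R) : Prop :=
  [/\ (forall i, measurable_fun setT (X i)),
      (forall i (B : set (vecR R k)), measurable B -> P (X i @^-1` B) = F B) &
      (forall (I : {fset nat}) (B : nat -> set (vecR R k)),
         (forall i, i \in I -> measurable (B i)) ->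
         P (\bigcap_(i in [set` I]) (X i @^-1` B i)) =
         (\prod_(i <- I) P (X i @^-1` B i))%E)].

Definition Sn k (n : nat) (x : nat -> 'rV[R]_k) (u : 'rV[R]_k) : 'M[R]_k :=
  (n%:R)^-1 *: \sum_(i < n) souter (x i - u).

Definition SF k (F : probability (vecR R k) R) (t : 'rV[R]_k) : 'M[R]_k :=
  \matrix_(i, j) (\int[F]_x (souter ((x : 'rV[R]_k) - t) i j)).

Definition Zvec k (t x : 'rV[R]_k) : 'rV[R]_(k * k) := vec (souter (x - t)).

Definition Wcov k (F : probability (vecR R k) R) (t : 'rV[R]_k) : 'M[R]_(k * k) :=
  \matrix_(a, b)
    (\int[F]_x (Zvec t x ord0 a * Zvec t x ord0 b)
     - (\int[F]_x Zvec t x ord0 a) * (\int[F]_x Zvec t x ord0 b)).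

(* mu is the k-variate normal distribution N_k(0, W), characterized by its
   characteristic function E exp(i u.Y) = exp(-u W u^T / 2) (real and
   imaginary parts separately). *)
Definition is_centered_normal k (mu : probability (vecR R k) R) (W : 'M[R]_k) : Prop :=
  forall u : 'rV[R]_k,
    \int[mu]_x cos (dotp u x) = expR (- ((u *m W *m u^T) ord0 ord0 / 2)) /\
    \int[mu]_x sin (dotp u x) = 0.

Definition cvg_distr k d (T : measurableType d) (P : probability T R)
  (Y : nat -> T -> 'rV[R]_k) (mu : probability (vecR R k) R) : Prop :=
  forall f : 'rV[R]_k -> R, continuous f -> (exists M : R, forall x, `|f x| <= M) ->
    (fun n => \int[P]_w f (Y n w)) @ \oo --> \int[mu]_x f x.

End Defs2.

(* Main.v *)
Require Import Defs.
From HB Require Import structures.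
From mathcomp Require Import all_boot all_order all_algebra finmap.
From mathcomp Require Import all_classical all_reals all_analysis.
From mathcomp Require Import measurable_realfun ring lra zify.
Import Order.TTheory GRing.Theory Num.Theory.
Import numFieldNormedType.Exports.
Local Open Scope classical_set_scope.
Local Open Scope ring_scope.
Set Implicit Arguments.
Unset Strict Implicit.
Unset Printing Implicit Defensive.

(** Write [S_n(u)] for the spatial sign covariance matrix centred at [u].  The
    entries of [x |-> s(x - u) s(x - u)^T] are bounded, homogeneous of degree
    zero and smooth off [x = u], so their first order Taylor remainder at
    [u = t] is [O ((|u - t| / |x - t|)^(3/2))] uniformly in [x].  Since
    [|t_n - t|] is of order [n^(-1/2)], the moment of order [-3/2] makes the
    remainder of [sqrt n (S_n(t_n) - S_n(t))] vanish, and the linear term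
    vanishes by the law of large numbers because the gradient has mean zero.

    The central limit theorem for [S_n(t)] comes from an inductive estimate
    of [E cos (th + sum)] over the number of summands.  Trigonometric
    functions suffice to test convergence in distribution: a continuous
    function on a cube is approximated, with no growth outside the cube, by a
    Bernstein polynomial in sines of the coordinates.  The limit law is built
    by writing [W] as a sum of outer products [a^T a] and adding independent
    multiples [g a] with [g] standard normal. *)

(** * Integrable functions *)

(** The location [t_n] may depend on the whole sample, so no independence between [t_n] and the
    summands is available. The remainder is therefore bounded by a product: a power of [|t_n - t|],
    which leaves the sum, times a power of [|X_l - t|], which is averaged over the sample. The power
    must be at most 2, the order of the Taylor remainder near [t], and at least 1, the growth of the
    linear term when [|t_n - t|] exceeds [|X_l - t|]; above 1 it also beats [sqrt n], since
    [sqrt n * n^(-3/4)] tends to 0. The gradient is of size [1 / |X - t|]. Condition (II) gives it a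
    first moment but no second one, hence a law of large numbers in mean, by truncation. Condition
    (II) also excludes an atom at [t], where the sign is not differentiable. Smallness of the
    remainder is measured by the mean of [min 1 |.|], which is bounded by integrals and adds up over
    entries. Complex numbers are avoided by cosines with an arbitrary phase [th]: the phases 0 and
    [- pi / 2] give the real and imaginary parts of a characteristic function. *)

Notation L1 mu f := (mu.-integrable setT (EFin \o f)).

Lemma archi_le0 (R : realType) (x C : R) :
  (forall N, x <= N.+1%:R^-1 * C) -> x <= 0.
Proof.
move=> xC; rewrite leNgt; apply/negP => x0.
have := xC (Num.truncn (C / x)); apply/negP; rewrite -ltNge ltr_pdivrMl//.
rewrite -ltr_pdivrMr//.
exact: Num.Theory.truncnS_gt.
Qed.

Lemma cvg0_harmonic (R : realType) (u : nat -> R) (C : R) :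
  (forall n, `|u n| <= n.+1%:R^-1 * C) -> u @ \oo --> 0.
Proof.
move=> uC; apply: norm_cvg0.
apply: (@squeeze_cvgr _ _ _ _ (cst 0) (fun n => n.+1%:R^-1 * C)).
- by apply: nearW => n; rewrite normr_ge0 uC.
- exact: cvg_cst.
- rewrite -(mul0r C); apply: cvgM; [exact: cvg_harmonic|exact: cvg_cst].
Qed.

Section integrals.
Context {R : realType} {d : measure_display} {T : measurableType d}.
Variable mu : {measure set T -> \bar R}.
Implicit Types f g : T -> R.

Lemma L1_measurable f : L1 mu f -> measurable_fun setT f.
Proof. by move=> /integrableP[/measurable_EFinP]. Qed.

Lemma L1D f g : L1 mu f -> L1 mu g -> L1 mu (fun x => f x + g x).
Proof.
move=> fi gi; rewrite (_ : _ \o _ = (EFin \o f) \+ (EFin \o g))%E//.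
exact: integrableD.
Qed.

Lemma L1Z c f : L1 mu f -> L1 mu (fun x => c * f x).
Proof.
move=> fi; rewrite (_ : _ \o _ = (fun x => c%:E * (EFin \o f) x)%E)//.
exact: integrableZl.
Qed.

Lemma L1N f : L1 mu f -> L1 mu (fun x => - f x).
Proof. by move=> /(L1Z (-1)); under eq_fun do rewrite mulN1r. Qed.

Lemma L1B f g : L1 mu f -> L1 mu g -> L1 mu (fun x => f x - g x).
Proof. by move=> fi gi; apply: L1D => //; exact: L1N. Qed.

Lemma L1_norm f : L1 mu f -> L1 mu (fun x => `|f x|).
Proof. exact: integrable_norm. Qed.

Lemma L1_le g f : measurable_fun setT f -> L1 mu g ->
  (forall x, `|f x| <= g x) -> L1 mu f.
Proof.
move=> mf gi fg; apply: le_integrable gi => //; first exact/measurable_EFinP.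
by move=> x _; rewrite /= lee_fin (le_trans (fg x)) ?ler_norm.
Qed.

Lemma L1_sum (I : Type) (s : seq I) (f : I -> T -> R) :
  (forall i, L1 mu (f i)) -> L1 mu (fun x => \sum_(i <- s) f i x).
Proof.
move=> fi; elim: s => [|i s IH].
  rewrite (_ : _ \o _ = cst 0%E); first exact: integrable0.
  by apply/funext => x /=; rewrite big_nil.
rewrite (_ : _ \o _ = EFin \o (fun x => f i x + \sum_(i <- s) f i x)).
  exact: L1D.
by apply/funext => x /=; rewrite big_cons.
Qed.

Lemma IntD f g : L1 mu f -> L1 mu g ->
  \int[mu]_x (f x + g x) = \int[mu]_x f x + \int[mu]_x g x.
Proof. by move=> fi gi; rewrite RintegralD. Qed.

Lemma IntB f g : L1 mu f -> L1 mu g ->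
  \int[mu]_x (f x - g x) = \int[mu]_x f x - \int[mu]_x g x.
Proof. by move=> fi gi; rewrite RintegralB. Qed.

Lemma IntZ c f : L1 mu f -> \int[mu]_x (c * f x) = c * \int[mu]_x f x.
Proof. by move=> fi; rewrite RintegralZl. Qed.

Lemma Int_sum (I : Type) (s : seq I) (f : I -> T -> R) :
  (forall i, L1 mu (f i)) ->
  \int[mu]_x (\sum_(i <- s) f i x) = \sum_(i <- s) \int[mu]_x f i x.
Proof.
move=> fi; elim: s => [|i s IH].
  under eq_Rintegral do rewrite big_nil.
  by rewrite big_nil Rintegral_cst// mul0r.
under eq_Rintegral do rewrite big_cons.
by rewrite big_cons IntD// ?IH//; exact: L1_sum.
Qed.

Lemma Int_le f g : L1 mu f -> L1 mu g -> (forall x, f x <= g x) ->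
  \int[mu]_x f x <= \int[mu]_x g x.
Proof. by move=> fi gi fg; exact: le_Rintegral. Qed.

Lemma Int_norm f : L1 mu f -> `|\int[mu]_x f x| <= \int[mu]_x `|f x|.
Proof. by move=> fi; exact: le_normr_Rintegral. Qed.

Lemma Int_norm_le f g : L1 mu f -> L1 mu g -> (forall x, `|f x| <= g x) ->
  `|\int[mu]_x f x| <= \int[mu]_x g x.
Proof.
move=> fi gi fg; apply: le_trans (Int_norm fi) _; apply: Int_le => //.
exact: L1_norm.
Qed.

Lemma Int_EFin f : L1 mu f -> (\int[mu]_x f x)%:E = (\int[mu]_x (f x)%:E)%E.
Proof. by move=> fi; rewrite fineK//; exact: integrable_fin_num. Qed.

End integrals.

Section probability_integrals.
Context {R : realType} {d : measure_display} {T : measurableType d}.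
Variable P : probability T R.
Implicit Types f g : T -> R.

Lemma L1_bounded f M : measurable_fun setT f -> (forall x, `|f x| <= M) ->
  L1 P f.
Proof.
move=> mf fM; apply: (L1_le _ _ (g := cst M)) => //.
exact: finite_measure_integrable_cst.
Qed.

Lemma L1_cst c : L1 P (fun=> c).
Proof. exact: finite_measure_integrable_cst. Qed.

Lemma Int_cst c : \int[P]_x c = c.
Proof.
by rewrite Rintegral_cst// [X in fine X](@probability_setT _ _ _ P) mulr1.
Qed.

Lemma Int_le_bound f M : measurable_fun setT f -> (forall x, `|f x| <= M) ->
  `|\int[P]_x f x| <= M.
Proof.
move=> mf fM; rewrite -[leRHS]Int_cst; apply: Int_norm_le => //.
- exact: L1_bounded fM.
- exact: L1_cst.
Qed.

Lemma Int_indic A : measurable A -> \int[P]_x \1_A x = fine (P A).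
Proof. by move=> mA; rewrite /Rintegral integral_indic// setIT. Qed.

End probability_integrals.

(** * From indicators to bounded functions *)

Section bounded_extension.
Context {R : realType} {d d1 d2 : measure_display}.
Context {V : measurableType d} {T1 : measurableType d1} {T2 : measurableType d2}.
Variables (mu1 : {measure set T1 -> \bar R}) (mu2 : {measure set T2 -> \bar R}).

Lemma measurable_level (f : V -> R) (k : int) : measurable_fun setT f ->
  measurable [set x | Num.floor (f x) = k].
Proof.
move=> mf.
rewrite (_ : [set x | _] = f @^-1` `[k%:~R, (k + 1)%:~R[%classic).
  by rewrite -[X in measurable X]setTI; apply: mf => //; exact: measurable_itv.
apply/seteqP; split => x /=; rewrite in_itv /=.
- by move=> <-; rewrite floor_le/= floorD1_gt.
- by move=> h; apply: floor_def; rewrite h.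
Qed.

(* Both sides are continuous for the uniform norm in g, and g is a uniform
   limit of simple functions. *)
Lemma bounded_extension (H1 : T1 -> R) (X1 : T1 -> V) (H2 : T2 -> R)
    (X2 : T2 -> V) (g : V -> R) (M : R) :
  measurable_fun setT X1 -> measurable_fun setT X2 ->
  L1 mu1 H1 -> L1 mu2 H2 ->
  (forall B, measurable B ->
    \int[mu1]_w (H1 w * \1_B (X1 w)) = \int[mu2]_w (H2 w * \1_B (X2 w))) ->
  measurable_fun setT g -> (forall x, `|g x| <= M) ->
  \int[mu1]_w (H1 w * g (X1 w)) = \int[mu2]_w (H2 w * g (X2 w)).
Proof.
move=> mX1 mX2 H1i H2i HB mg gM.
have L1M d' (T' : measurableType d') (mu' : {measure set T' -> \bar R})
    (H X : T' -> R) (M' : R) : L1 mu' H -> measurable_fun setT X ->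
    (forall x, `|X x| <= M') -> L1 mu' (fun w => H w * X w).
  move=> Hi mX XM; apply: (L1_le _ (L1Z M' (L1_norm Hi))) => [|x].
    by apply: measurable_funM => //; exact: L1_measurable Hi.
  by rewrite normrM mulrC ler_wpM2r.
(* [g] rounded down to a multiple of [1 / (N + 1)]: the level sets are measurable, finitely many are
   nonempty because [g] is bounded, and the error is at most the mesh. *)
pose gN N x : R := (Num.floor (N.+1%:R * g x))%:~R / N.+1%:R.
have gNg N x : `|g x - gN N x| <= N.+1%:R^-1.
  rewrite /gN -[X in X - _](mulKf (_ : N.+1%:R != 0)) ?pnatr_eq0//.
  rewrite [_^-1 * _]mulrC -mulrBl normrM [X in _ * X]ger0_norm ?invr_ge0//.
  rewrite ler_piMl ?invr_ge0// ger0_norm ?subr_ge0 ?floor_le//.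
  by rewrite lerBlDl ltW// -[X in _ < _ + X]/(1%:~R) -intrD floorD1_gt.
pose B N := Num.ceil (N.+1%:R * `|M|) : int.
pose lev N k := [set x | Num.floor (N.+1%:R * g x) = k].
have mlev N k : measurable (lev N k).
  by apply: measurable_level; exact: measurable_funM.
(* The integers from [- |B N| - 1] to [|B N| + 1]; the margin of one pays for the [floor]. *)
pose ks N := [seq (i%:Z - `|B N|%N%:Z - 1)%R | i <- iota 0 (2 * `|B N|%N + 3)%N].
have gNE N x : gN N x = \sum_(k <- ks N) k%:~R / N.+1%:R * \1_(lev N k) x.
  have kin : Num.floor (N.+1%:R * g x) \in ks N.
    set k := Num.floor _.
    have kB : (`|k| <= `|B N|%N%:Z + 1)%R.
      have h1 : `|k%:~R : R| <= `|N.+1%:R * g x| + 1.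
        rewrite -lerBlDl; apply: le_trans (lerB_dist _ _) _.
        rewrite distrC ger0_norm ?subr_ge0 ?floor_le// lerBlDl ltW//.
        by rewrite -[X in _ < _ + X]/(1%:~R) -intrD floorD1_gt.
      have h2 : `|N.+1%:R * g x| <= (B N)%:~R.
        rewrite normrM ger0_norm//; apply: le_trans (ceil_ge _).
        by rewrite ler_wpM2l// (le_trans (gM x))// ler_norm.
      rewrite -(ler_int R) intr_norm intrD; apply: le_trans h1 _.
      by rewrite lerD2r (le_trans h2)// ler_int abszE ler_norm.
    apply/mapP; exists `|(k + `|B N|%N%:Z + 1)%R|%N.
      rewrite mem_iota /= add0n; move: kB; lia.
    by move: kB; lia.
  have uks : uniq (ks N).
    by rewrite map_inj_uniq ?iota_uniq// => i j /=; lia.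
  rewrite (bigD1_seq _ kin uks)/= indicE mem_set// mulr1 big1 ?addr0// => k kx.
  by rewrite indicE memNset ?mulr0//= => /eqP; rewrite eq_sym (negbTE kx).
have step d' (T' : measurableType d') (mu' : {measure set T' -> \bar R})
    (H : T' -> R) (X : T' -> V) N : L1 mu' H -> measurable_fun setT X ->
  \int[mu']_w (H w * gN N (X w)) =
  \sum_(k <- ks N) k%:~R / N.+1%:R * \int[mu']_w (H w * \1_(lev N k) (X w)).
  move=> Hi mX; under eq_Rintegral => w _.
    rewrite gNE mulr_sumr; under eq_bigr do rewrite mulrCA.
    over.
  have Li k : L1 mu' (fun w => H w * \1_(lev N k) (X w)).
    apply: (L1M _ _ _ _ _ 1) => // [|x]; last first.
      by rewrite indicE ger0_norm//; case: (_ \in _).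
    by apply: (@measurableT_comp _ _ _ _ _ _ (\1_(lev N k) : V -> R)).
  rewrite Int_sum => [|k]; last exact/L1Z/Li.
  by apply: eq_bigr => k _; rewrite IntZ.
have gL d' (T' : measurableType d') (mu' : {measure set T' -> \bar R})
    (H : T' -> R) (X : T' -> V) : L1 mu' H -> measurable_fun setT X ->
    L1 mu' (fun w => H w * g (X w)).
  move=> Hi mX; apply: (L1M _ _ _ _ _ M) => //; exact: measurableT_comp.
have mgN N : measurable_fun setT (gN N).
  rewrite (_ : gN N = fun x => \sum_(k <- ks N) k%:~R / N.+1%:R * \1_(lev N k) x).
    by apply: measurable_sum => k; apply: measurable_funM.
  by apply/funext => x; exact: gNE.
have gNL d' (T' : measurableType d') (mu' : {measure set T' -> \bar R})
    (H : T' -> R) (X : T' -> V) N : L1 mu' H -> measurable_fun setT X ->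
    L1 mu' (fun w => H w * gN N (X w)).
  move=> Hi mX; apply: (L1M _ _ _ _ _ (M + N.+1%:R^-1)) => // [|x].
    exact: measurableT_comp.
  rewrite -[gN _ _](subKr (g (X x))) (le_trans (ler_normB _ _))//.
  exact: lerD.
have close d' (T' : measurableType d') (mu' : {measure set T' -> \bar R})
    (H : T' -> R) (X : T' -> V) N : L1 mu' H -> measurable_fun setT X ->
  `|\int[mu']_w (H w * g (X w)) - \int[mu']_w (H w * gN N (X w))|
    <= N.+1%:R^-1 * \int[mu']_w `|H w|.
  move=> Hi mX; rewrite -IntB; [|exact: gL|exact: gNL].
  rewrite -IntZ; last exact: L1_norm.
  apply: Int_norm_le => [||x].
  - by apply: L1B; [exact: gL|exact: gNL].
  - exact/L1Z/L1_norm.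
  - by rewrite -mulrBr normrM mulrC ler_wpM2r.
set a := LHS; set b := RHS; apply/eqP; rewrite -subr_eq0 -normr_eq0.
apply/eqP/le_anti; rewrite normr_ge0 andbT.
set C := \int[mu1]_w `|H1 w| + \int[mu2]_w `|H2 w|.
have key N : `|a - b| <= N.+1%:R^-1 * C.
  have e : \int[mu1]_w (H1 w * gN N (X1 w)) = \int[mu2]_w (H2 w * gN N (X2 w)).
    by rewrite !step//; apply: eq_bigr => k _; rewrite HB.
  have := close _ _ mu1 H1 X1 N H1i mX1.
  have := close _ _ mu2 H2 X2 N H2i mX2; rewrite -/a -/b -e => h2 h1.
  rewrite mulrDr; apply: le_trans (lerD h1 h2).
  by rewrite [X in _ <= _ + X]distrC (le_trans _ (ler_normD _ _))// addrA subrK.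
exact: archi_le0 key.
Qed.
End bounded_extension.

(** Both weights of [bounded_extension] are 1 here. Its other uses take as weight a density
    ([normal_cos]) or a product of independent factors ([iid_prod]). *)
Lemma Int_law (R : realType) d d' (T : measurableType d) (V : measurableType d')
    (P : probability T R) (X : T -> V) (Q : probability V R) (g : V -> R) (M : R) :
  measurable_fun setT X ->
  (forall B, measurable B -> P (X @^-1` B) = Q B) ->
  measurable_fun setT g -> (forall x, `|g x| <= M) ->
  \int[P]_w g (X w) = \int[Q]_x g x.
Proof.
move=> mX PQ mg gM.
have HB B : measurable B ->
    \int[P]_w (cst 1 w * \1_B (X w)) = \int[Q]_x (cst 1 x * \1_B x).
  move=> mB; transitivity (\int[P]_w \1_(X @^-1` B) w).
    apply: eq_Rintegral => w _; rewrite mul1r !indicE.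
    have -> : (X w \in B) = (w \in X @^-1` B) by apply/idP/idP; rewrite !inE.
    by [].
  transitivity (\int[Q]_w \1_B w); last first.
    by apply: eq_Rintegral => w _; rewrite mul1r.
  by rewrite !Int_indic// ?PQ// -[X in measurable X]setTI; exact: mX.
transitivity (\int[P]_w (cst 1 w * g (X w))).
  by apply: eq_Rintegral => w _; rewrite mul1r.
rewrite (bounded_extension mX (@measurable_id _ _ _) (L1_cst P 1) (L1_cst Q 1) HB mg gM).
by apply: eq_Rintegral => w _; rewrite mul1r.
Qed.

(** * Characteristic function of the standard normal law *)

Section taylor.
Variable R : realType.
Implicit Types x y : R.

(** Covers both signs of [x]. The trigonometric bounds below form a chain: each remainder has the
    previous one as derivative up to sign, and the mean value theorem adds one power of [|x|], at
    the price of the factorials. *)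
Lemma mvt0 (f df : R -> R) x : (forall y, is_derive y (1 : R) f (df y)) ->
  exists2 c, `|c| <= `|x| & f x - f 0 = df c * x.
Proof.
move=> dfE.
have cf a b : {within `[a, b], continuous f}.
  apply/continuous_subspaceT => r.
  exact/differentiable_continuous/derivable1_diffP.
have [x0|x0] := leP 0 x.
  have [c] := MVT_segment x0 (fun y _ => dfE y) (cf _ _).
  rewrite in_itv/= subr0 => /andP[c0 cx] e; exists c => //.
  by rewrite !ger0_norm.
have [c] := MVT_segment (ltW x0) (fun y _ => dfE y) (cf _ _).
rewrite in_itv/= sub0r => /andP[cx c0] e; exists c.
  by rewrite !ler0_norm ?lerN2// ltW.
by rewrite -opprB e mulrN opprK.
Qed.

Lemma sin_le_norm x : `|sin x| <= `|x|.
Proof.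
have [c _] := @mvt0 sin cos x (@is_derive_sin R).
by rewrite sin0 subr0 => ->; rewrite normrM ler_piMl// cos_max.
Qed.

Lemma cos_taylor1 x : `|cos x - 1| <= x ^+ 2.
Proof.
have [c cx] := @mvt0 cos (fun y => - sin y) x (@is_derive_cos R).
rewrite cos0 => ->; rewrite normrM normrN -normr_id -[leRHS]real_normK ?num_real//.
by rewrite expr2 normr_id ler_wpM2r// (le_trans (sin_le_norm c)).
Qed.

Lemma sin_taylor x : `|sin x - x| <= `|x| ^+ 3.
Proof.
have [c cx] := @mvt0 (fun y => sin y - y) (fun y => cos y - 1) x
  (fun y => is_deriveB _ _).
rewrite sin0 subr0 subr0 => ->; rewrite normrM [leRHS]exprSr ler_wpM2r//.
rewrite (le_trans (cos_taylor1 c))// -[leLHS]real_normK ?num_real//.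
by rewrite ler_sqr// ?nnegrE.
Qed.

Lemma cos_taylor2 x : `|cos x - 1 + x ^+ 2 / 2| <= x ^+ 4.
Proof.
have dE y : is_derive y (1 : R) (fun y => cos y - 1 + y ^+ 2 / 2) (y - sin y).
  by apply: is_derive_eq; rewrite /GRing.scale/=; field.
have [c cx] := mvt0 x dE.
rewrite cos0 subrr add0r expr0n/= mul0r subr0 => ->.
rewrite normrM -[leRHS]ger0_norm ?exprn_even_ge0// normrX [leRHS]exprSr.
by rewrite ler_wpM2r// distrC (le_trans (sin_taylor c))// lerXn2r// nnegrE.
Qed.

(** With [u = expR (- x) - 1 + x], the inequality [(1 + x) * expR (- x) <= 1] reads
    [u + x * u <= x ^+ 2], and [x * u] is nonnegative. *)
Lemma expRN_taylor x : 0 <= x -> `|expR (- x) - 1 + x| <= x ^+ 2.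
Proof.
move=> x0.
have d1 y : is_derive y (1 : R) (fun y => expR (- y)) (- expR (- y)).
  by apply: is_derive_eq; rewrite /GRing.scale/=; ring.
have d2 y : is_derive y (1 : R) (fun y => expR (- y) - 1 + y) (1 - expR (- y)).
  by apply: is_derive_eq; rewrite /GRing.scale/=; ring.
rewrite ger0_norm; last by have := expR_ge1Dx (- x); lra.
have : (1 + x) * expR (- x) <= 1.
  by rewrite -ler_pdivlMr ?expR_gt0// div1r -expRN opprK expR_ge1Dx.
have h : 0 <= expR (- x) - 1 + x by have := expR_ge1Dx (- x); lra.
by have := mulr_ge0 x0 h; nra.
Qed.

End taylor.

Section normal_characteristic_function.
Variable R : realType.
Implicit Types t x th : R.
Local Notation leb := (@lebesgue_measure R).
Let phi : R -> R := normal_pdf 0 1.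
(** [phi] is a multiple of [q ^+ 2]. One factor [q] absorbs a power of [x], the other remains as the
    integrable majorant [G] of [|x| * phi x]. *)
Let q x : R := expR (- (x ^+ 2 / 4)).

Let phiE x : phi x = normal_peak 1 * expR (- (x ^+ 2 / 2)).
Proof.
rewrite /phi normal_pdfE ?oner_neq0//; congr (_ * expR _).
by rewrite subr0 expr1n; field.
Qed.

Let q_ge0 x : 0 <= q x. Proof. exact: expR_ge0. Qed.

Let phi_q x : phi x = normal_peak 1 * q x * q x.
Proof. by rewrite phiE -mulrA -expRD; congr (_ * expR _); field. Qed.

Let pk_ge0 : 0 <= normal_peak (1 : R). Proof. exact: normal_peak_ge0. Qed.

Let q_L1 : L1 leb q.
Proof.
have s2 : Num.sqrt (2 : R) != 0 by rewrite gt_eqF// sqrtr_gt0.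
have pk0 : normal_peak (Num.sqrt (2 : R)) != 0.
  by rewrite gt_eqF// normal_peak_gt0.
(* [q] is proportional to the normal density of variance 2. *)
rewrite (_ : q = fun x => (normal_peak (Num.sqrt 2))^-1 * normal_pdf 0 (Num.sqrt 2) x).
  exact/L1Z/integrable_normal_pdf.
apply/funext => x; rewrite normal_pdfE// mulKf//; congr expR.
by rewrite subr0 sqr_sqrtr//; field.
Qed.

(** The constant comes from [|x| <= (1 + x ^+ 2) / 2], [q x <= 1] and [x ^+ 2 * q x <= 4]. *)
Let xq_le x : `|x| * q x <= 5 / 2.
Proof.
have h1 : x ^+ 2 * q x <= 4.
  have := expR_ge1Dx (x ^+ 2 / 4); rewrite /q expRN => h.
  have e0 : 0 < expR (x ^+ 2 / 4) by exact: expR_gt0.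
  by rewrite ler_pdivrMr//; nra.
have h2 : q x <= 1.
  by rewrite /q -expR0 ler_expR oppr_le0 mulr_ge0 ?sqr_ge0.
have h3 : `|x| <= (1 + x ^+ 2) / 2.
  have := sqr_ge0 (`|x| - 1); rewrite -(real_normK (num_real x)); nra.
have := q_ge0 x; nra.
Qed.

Let phi_ge0 x : 0 <= phi x. Proof. exact: normal_pdf_ge0. Qed.

Let phi_L1 : L1 leb phi. Proof. exact: integrable_normal_pdf. Qed.

Let G x := 5 / 2 * normal_peak 1 * q x.

Let xphi_le x : `|x| * phi x <= G x.
Proof.
rewrite phi_q /G; have := xq_le x; have := pk_ge0; have := q_ge0 x => a b c.
have := ler_wpM2r (mulr_ge0 b a) c; nra.
Qed.

Let G_L1 : L1 leb G. Proof. exact: L1Z. Qed.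

Let cmeas (f df : R -> R) : (forall x, is_derive x (1 : R) f (df x)) ->
  measurable_fun setT f.
Proof.
by move=> fE; apply: continuous_measurable_fun => x;
  exact/differentiable_continuous/derivable1_diffP.
Qed.

Let dphi x : is_derive x (1 : R) phi (- (x * phi x)).
Proof.
rewrite (_ : phi = fun x => normal_peak 1 * expR (- (x ^+ 2 / 2))).
  by apply: is_derive_eq; rewrite /GRing.scale/=; field.
by apply/funext => y; exact: phiE.
Qed.

Let mcos t th : measurable_fun setT (fun x : R => cos (t * x + th)).
Proof. by apply: cmeas => x; apply: is_derive_eq. Qed.

Let cphi_L1 t th : L1 leb (fun x => cos (t * x + th) * phi x).
Proof.
have dphi' := dphi.
apply: (L1_le _ phi_L1) => [|x].
  by apply: cmeas => x; apply: is_derive_eq.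
by rewrite normrM (ger0_norm (phi_ge0 x)) ler_piMl// cos_max.
Qed.

Let xsphi_L1 t th : L1 leb (fun x => sin (t * x + th) * (x * phi x)).
Proof.
have dphi' := dphi.
apply: (L1_le _ G_L1) => [|x].
  by apply: cmeas => x; apply: is_derive_eq.
rewrite !normrM (ger0_norm (phi_ge0 x)) (le_trans _ (xphi_le x))//.
by rewrite ler_piMl ?mulr_ge0// sin_max.
Qed.

(** The [x]-derivative of [sin (t * x + th) * phi x]. That it integrates to zero is the integration
    by parts behind the differential equation [h' = - t * h] of the cosine transform. *)
Let GE t th x := t * (cos (t * x + th) * phi x) - sin (t * x + th) * (x * phi x).

Let dGE t th x :
  is_derive x (1 : R) (fun x => sin (t * x + th) * phi x) (GE t th x).
Proof.
have dphi' := dphi.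
by apply: is_derive_eq; rewrite /GE /GRing.scale/=; ring.
Qed.

Let is_derive_cont (f df : R -> R) : (forall x, is_derive x (1 : R) f (df x)) ->
  continuous f.
Proof. by move=> fE x; exact/differentiable_continuous/derivable1_diffP. Qed.

Let GE_cont t th : continuous (GE t th).
Proof.
by have dphi' := dphi; apply: is_derive_cont.
Qed.

Let GE_L1 t th : L1 leb (GE t th).
Proof. by apply: L1B => //; exact: L1Z. Qed.

Let int_GE_itv t th (n : nat) :
  (\int[leb]_(x in `[(- n.+1%:R)%R, n.+1%:R]) (GE t th x)%:E =
   (sin (t * n.+1%:R + th) * phi n.+1%:R - sin (t * - n.+1%:R + th) * phi (- n.+1%:R))%:E)%E.
Proof.
have cf : continuous (fun x => sin (t * x + th) * phi x).
  exact: is_derive_cont (dGE t th).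
rewrite EFinB; apply: (@continuous_FTC2 _ _ (fun x => sin (t * x + th) * phi x)).
- by rewrite gtrN.
- by apply: continuous_subspaceT; exact: GE_cont.
- split => [x _||].
  + by have := dGE t th x => -[].
  + exact/cvg_at_right_filter/cf.
  + exact/cvg_at_left_filter/cf.
- by move=> x _; rewrite derive1E; apply: derive_val.
Qed.

(** Over [[- (n + 1), n + 1]] the integral reduces to boundary values, of order [1 / (n + 1)] by
    [xphi_le]; dominated convergence passes to the whole line. *)
Let int_GE t th : \int[leb]_x GE t th x = 0.
Proof.
pose I n := `[(- n.+1%:R)%R, n.+1%:R]%classic : set R.
pose v (n : nat) := sin (t * n.+1%:R + th) * phi n.+1%:R
  - sin (t * - n.+1%:R + th) * phi (- n.+1%:R).
have mG : measurable_fun setT (EFin \o GE t th).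
  by apply/measurable_EFinP; exact: L1_measurable (GE_L1 t th).
have cv : (fun n => (v n)%:E) @ \oo --> (\int[leb]_x (GE t th x)%:E)%E.
  have [] := @dominated_convergence _ _ _ leb setT measurableT
    (fun n => (EFin \o GE t th) \_ (I n)) (EFin \o GE t th)
    (fun x => `|GE t th x|%:E) _ mG _ (L1_norm (GE_L1 t th)) _.
  - move=> n; have mI : measurable (I n) by exact: measurable_itv.
    by apply: (iffLR (measurable_restrictT _ mI)); exact: measurable_funTS mG.
  - apply: aeW => x _; apply: cvg_near_cst; near=> n.
    rewrite patchE ifT// inE /I/= in_itv/= -ler_norml.
    by rewrite (@le_trans _ _ n%:R)// ?ler_nat//; near: n; exact: nbhs_infty_ger.
  - apply: aeW => x n _; rewrite patchE; case: ifPn => _ //=.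
    by rewrite normr0 lee_fin.
  move=> _ _; rewrite (_ : [sequence _]_n = fun n => (v n)%:E)//.
  by apply/funext => n /=; rewrite -integral_mkcond int_GE_itv.
have v0 : v @ \oo --> 0.
  have hphi n (s : R) : `|s| = n.+1%:R -> phi s <= n.+1%:R^-1 * (5 / 2 * normal_peak 1).
    move=> sn; rewrite ler_pdivlMl ?ltr0n// -sn (le_trans (xphi_le s))//.
    rewrite /G ler_piMr ?mulr_ge0//.
    by rewrite /q -expR0 ler_expR oppr_le0 mulr_ge0 ?sqr_ge0.
  apply: (@cvg0_harmonic _ _ (5 * normal_peak 1)) => n.
  have h1 := hphi n n.+1%:R (normr_nat _ _).
  have h2 := hphi n (- n.+1%:R) (etrans (normrN _) (normr_nat _ _)).
  have sp (a b : R) : 0 <= b -> `|sin a * b| <= b.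
    by move=> b0; rewrite normrM (ger0_norm b0) ler_piMl// sin_max.
  have := sp (t * n.+1%:R + th) _ (phi_ge0 n.+1%:R).
  have := sp (t * - n.+1%:R + th) _ (phi_ge0 (- n.+1%:R)).
  move=> a b; rewrite /v (le_trans (ler_normB _ _))//.
  rewrite (_ : 5 * normal_peak 1 = 5 / 2 * normal_peak 1 + 5 / 2 * normal_peak 1).
    by rewrite mulrDr; exact: lerD (le_trans b h1) (le_trans a h2).
  by field.
have : (\int[leb]_x (GE t th x)%:E = 0)%E.
  apply: (@cvg_unique _ (@ereal_hausdorff R) _ _ _ _ cv).
  by apply: cvg_EFin; [exact: nearW|exact: v0].
by rewrite /Rintegral => ->.
Unshelve. all: by end_near. Qed.

Let dh t th : is_derive t (1 : R) (fun t => \int[leb]_x (cos (t * x + th) * phi x))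
  (- t * \int[leb]_x (cos (t * x + th) * phi x)).
Proof.
pose f (t x : R) := cos (t * x + th) * phi x.
have dfx s x : is_derive s (1 : R) (f ^~ x) (- (sin (s * x + th) * (x * phi x))).
  by rewrite /f; apply: is_derive_eq; rewrite /GRing.scale/=; ring.
have p1 s x : partial1of2 f s x = - (sin (s * x + th) * (x * phi x)).
  by rewrite /partial1of2 derive1E; apply: derive_val.
have Ia : `]t - 1, t + 1[%classic t by rewrite /= in_itv/=; lra.
have i1 (x : R) : `]t - 1, t + 1[%classic x -> leb.-integrable setT (EFin \o f x).
  by move=> _; exact: cphi_L1.
have i2 (s x : R) : `]t - 1, t + 1[%classic s -> setT x -> derivable (f ^~ x) s 1.
  by move=> _ _; case: (dfx s x).
have i3 (x : R) : 0 <= G x by rewrite !mulr_ge0.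
have i4 (s x : R) : `]t - 1, t + 1[%classic s -> setT x -> `|partial1of2 f s x| <= G x.
  move=> _ _; rewrite p1 normrN !normrM (ger0_norm (phi_ge0 x)).
  by rewrite (le_trans _ (xphi_le x))// ler_piMl ?mulr_ge0// sin_max.
have D1 := derivable_under_integral measurableT Ia i1 i2 i3 G_L1 i4.
have D2 := differentiation_under_integral measurableT Ia i1 i2 i3 G_L1 i4.
apply: DeriveDef => //; rewrite -derive1E D2.
under eq_Rintegral do rewrite p1 -mulN1r.
rewrite IntZ// mulN1r mulNr; congr (- _).
have := int_GE t th; rewrite /GE IntB//; last exact: L1Z.
by rewrite IntZ// => /eqP; rewrite subr_eq0 => /eqP ->.
Qed.

(** By [dh], the transform times [expR (s ^+ 2 / 2)] has derivative zero, hence equals its value at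
    0. The phase [th] also lets a further independent variable be absorbed when Gaussian summands
    are added. *)
Lemma normal_cos t th :
  \int[normal_prob (0 : R) 1]_x cos (t * x + th) = cos th * expR (- (t ^+ 2 / 2)).
Proof.
transitivity (\int[leb]_x (phi x * cos (t * x + th))).
  under eq_Rintegral do rewrite -[cos _]mul1r.
  apply: (@bounded_extension _ _ _ _ _ _ _ (normal_prob (0 : R) 1) leb
    (cst 1) id phi id (fun x => cos (t * x + th)) 1) => // [|B mB||x].
  - exact: L1_cst.
  - rewrite (eq_Rintegral _ (g := \1_B)) => [|x _]; last by rewrite mul1r.
    rewrite Int_indic// /normal_prob /Rintegral -/phi; congr fine.
    transitivity (\int[leb]_(x in B) (phi x)%:E)%E => //.
    rewrite [LHS]integral_mkcond; apply: eq_integral => x _.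
    by rewrite patchE indicE; case: ifPn; rewrite ?mulr1 ?mulr0.
  - exact: mcos.
  - exact: cos_max.
under eq_Rintegral do rewrite mulrC.
pose h s := \int[leb]_x (cos (s * x + th) * phi x).
have dk s : is_derive s (1 : R) (fun s => h s * expR (s ^+ 2 / 2)) 0.
  have dhs := dh s th.
  by apply: is_derive_eq; rewrite /GRing.scale/= /h; field.
have := is_derive_0_is_cst t 0 dk.
rewrite expr0n/= mul0r expR0 mulr1 -/(h t) {2}/h.
under eq_Rintegral do rewrite mul0r add0r.
rewrite IntZ// (_ : \int[leb]_x _ = 1) ?mulr1; last first.
  by rewrite /Rintegral /phi integral_normal_pdf.
by move=> <-; rewrite expRN mulfK// gt_eqF// expR_gt0.
Qed.

End normal_characteristic_function.

(** * Existence of centred normal laws *)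

Section vector_measurability.
Context {R : realType} {k : nat}.

Lemma coord_measurable (i : 'I_k) :
  measurable_fun setT (fun v : vecR R k => (v : 'rV[R]_k) ord0 i).
Proof.
move=> _ A mA; rewrite setTI; apply: sub_sigma_algebra.
by exists i, A.
Qed.

Lemma vec_measurable d (T : measurableType d) (X : T -> vecR R k) :
  (forall i, measurable_fun setT (fun w => (X w : 'rV[R]_k) ord0 i)) ->
  measurable_fun setT X.
Proof.
move=> mX; apply: (@measurability _ _ T (vecR R k) setT X (@coord_sets R k) erefl).
move=> _ [_ [i [A [mA ->]]] <-].
exact: mX.
Qed.

Lemma dotp_measurable (u : 'rV[R]_k) :
  measurable_fun setT (fun v : vecR R k => dotp u v).
Proof.
apply: measurable_sum => i; apply: measurable_funM => //.
exact: coord_measurable.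
Qed.

Lemma vecB_measurable (t : 'rV[R]_k) d (T : measurableType d) (X : T -> vecR R k) :
  measurable_fun setT X ->
  measurable_fun setT (fun w => ((X w : 'rV[R]_k) - t : vecR R k)).
Proof.
move=> mX; apply: vec_measurable => i; under eq_fun do rewrite !mxE.
by apply: measurable_funB => //; exact: measurableT_comp (coord_measurable i) mX.
Qed.

Lemma enorm_measurable : measurable_fun setT (@enorm R k : vecR R k -> R).
Proof.
apply: (measurableT_comp (continuous_measurable_fun (@sqrt_continuous R))).
apply: measurable_sum => i.
apply: measurable_funX; exact: coord_measurable.
Qed.

End vector_measurability.

Section dotp_theory.
Variables (R : realType) (k : nat).
Implicit Types u v w : 'rV[R]_k.

Lemma dotpDl u v w : dotp (u + v) w = dotp u w + dotp v w.
Proof. by rewrite -big_split; apply: eq_bigr => i _; rewrite mxE mulrDl. Qed.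

Lemma dotpNl u w : dotp (- u) w = - dotp u w.
Proof. by rewrite -sumrN; apply: eq_bigr => i _; rewrite mxE mulNr. Qed.

Lemma dotpBl u v w : dotp (u - v) w = dotp u w - dotp v w.
Proof. by rewrite dotpDl dotpNl. Qed.

Lemma dotpDr u v w : dotp u (v + w) = dotp u v + dotp u w.
Proof. by rewrite -big_split; apply: eq_bigr => i _; rewrite mxE mulrDr. Qed.

Lemma dotpZr a u v : dotp u (a *: v) = a * dotp u v.
Proof. by rewrite mulr_sumr; apply: eq_bigr => i _; rewrite mxE mulrCA. Qed.

Lemma dotp0r u : dotp u 0 = 0.
Proof. by rewrite /dotp big1// => i _; rewrite mxE mulr0. Qed.

Lemma dotp0l u : dotp 0 u = 0.
Proof. by rewrite /dotp big1// => i _; rewrite mxE mul0r. Qed.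

End dotp_theory.

Section gaussian.
Variable R : realType.

(* Outer products are split off one at a time, each step clearing a diagonal
   entry without creating a nonzero one. *)
Lemma psd_sum_squares k (W : 'M[R]_k) : W^T = W ->
  (forall u : 'rV_k, 0 <= (u *m W *m u^T) ord0 ord0) ->
  exists s : seq 'rV[R]_k, forall u : 'rV_k,
    (u *m W *m u^T) ord0 ord0 = \sum_(a <- s) dotp u a ^+ 2.
Proof.
have [n] := ubnP #|[pred i | W i i != 0]|.
elim: n W => // n IH W; rewrite ltnS => Wn Wsym Wpsd.
pose B (u v : 'rV[R]_k) := (u *m W *m v^T) ord0 ord0.
have Bsym u v : B u v = B v u.
  by rewrite /B -[in LHS](trmxK (u *m W *m v^T)) mxE !trmx_mul trmxK Wsym mulmxA.
have BDl u v w : B (u + v) w = B u w + B v w by rewrite /B !mulmxDl mxE.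
have BZl a u w : B (a *: u) w = a * B u w by rewrite /B -!scalemxAl mxE.
have BDr u v w : B w (u + v) = B w u + B w v by rewrite Bsym BDl !(Bsym w).
have BZr a u w : B w (a *: u) = a * B w u by rewrite Bsym BZl !(Bsym w).
pose e i : 'rV[R]_k := delta_mx 0 i.
have Be u i : B u (e i) = (u *m W) ord0 i.
  by rewrite /B /e trmx_delta -colE mxE.
have Bee i j : B (e i) (e j) = W i j by rewrite Be /e -rowE mxE.
have [i /= Wi|W0] := pickP (fun i => W i i != 0); last first.
  exists [::] => u; rewrite big_nil.
  suff -> : W = 0 by rewrite mulmx0 mul0mx mxE.
  apply/matrixP => i j; rewrite mxE.
  have Wd l : W l l = 0 by have /negbFE/eqP := W0 l.
  (* With zero diagonal, the form at [2^-1 *: e i + x *: e j] is [x * W i j]; the signs of [x = 1]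
     and [x = -1] force the entry to vanish. *)
  have q x : 0 <= x * W i j.
    have := Wpsd (2^-1 *: e i + x *: e j); rewrite -/(B _ _).
    rewrite !(BDl, BDr, BZl, BZr) !Bee !Wd (_ : W j i = W i j); last first.
      by rewrite -[in LHS]Wsym mxE.
    by congr (_ <= _); field.
  by have := q 1; have := q (-1); lra.
have ci : 0 < W i i by rewrite lt_def Wi/= -Bee; exact: Wpsd.
(* Scaled so that [a^T *m a] has the same [i]-th row and column as [W]; [W'] is the Schur complement
   of the pivot [W i i], padded with zeros. *)
pose a : 'rV[R]_k := (Num.sqrt (W i i))^-1 *: row i W.
pose W' := W - a^T *m a.
have sq : Num.sqrt (W i i) * Num.sqrt (W i i) = W i i.
  by rewrite -expr2 sqr_sqrtr// ltW.
have s0 : Num.sqrt (W i i) != 0 by rewrite gt_eqF// sqrtr_gt0.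
have ua u : dotp u a = B u (e i) / Num.sqrt (W i i).
  rewrite /a dotpZr mulrC Be; congr (_ / _); rewrite mxE; apply: eq_bigr => j _.
  by rewrite mxE -[in LHS]Wsym mxE.
have W'q u : (u *m W' *m u^T) ord0 ord0 = B u u - dotp u a ^+ 2.
  rewrite /W' mulmxBr mulmxBl [LHS]mxE -/(B u u) [X in _ + X]mxE; congr (_ - _).
  rewrite mulmxA -[u *m a^T *m a *m u^T]mulmxA mxE big_ord1 expr2.
  congr (_ * _); rewrite mxE; apply: eq_bigr => j _.
    by rewrite [a^T _ _]mxE.
  by rewrite [u^T _ _]mxE mulrC.
have W'psd (u : 'rV_k) : 0 <= (u *m W' *m u^T) ord0 ord0.
  (* Completing the square: the right multiple of [e i] subtracted from [u] minimises the form of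
     [W], and the minimum is the form of [W'] at [u]. *)
  rewrite W'q ua; have := Wpsd (u + (- (B u (e i) / W i i)) *: e i).
  rewrite -/(B _ _) !(BDl, BDr, BZl, BZr) (Bsym (e i) u) Bee.
  congr (_ <= _); rewrite expr2 mulrACA -invfM sq; field; exact: Wi.
have W'sym : W'^T = W' by rewrite /W' linearB/= trmx_mul trmxK Wsym.
have W'd j : W' j j = W j j - (W j i) ^+ 2 / W i i.
  have := W'q (e j); rewrite ua Bee -[(e j) *m W' *m (e j)^T]mulmxA /e.
  rewrite trmx_delta -colE -rowE !mxE => ->.
  by rewrite Bee expr2 mulrACA -invfM sq -expr2.
have card : (#|[pred j | W' j j != 0%R]| < n)%N.
  apply: leq_trans Wn; apply: proper_card; apply/properP; split.
    (* If [W j j = 0], then [W' j j = - (W j i) ^+ 2 / W i i <= 0], while [W'psd] gives the opposite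
       sign, so the entry stays zero. *)
    apply/fintype.subsetP => j; rewrite !inE; apply: contraNneq => Wj.
    have : 0 <= W' j j.
      have := W'psd (e j); rewrite -[(e j) *m W' *m (e j)^T]mulmxA /e.
      by rewrite trmx_delta -colE -rowE !mxE.
    rewrite W'd Wj sub0r oppr_ge0 => h.
    by rewrite oppr_eq0 eq_le h divr_ge0 ?sqr_ge0 ?ltW.
  exists i; rewrite !inE//.
  by rewrite negbK W'd expr2 mulfK// subrr.
have [s sE] := IH W' card W'sym W'psd.
exists (a :: s) => u; rewrite big_cons -sE W'q.
by rewrite addrC subrK.
Qed.

Lemma cos_dotp_measurable k (u : 'rV[R]_k) th :
  measurable_fun setT (fun x : vecR R k => cos (dotp u x + th)).
Proof.
apply: (measurableT_comp (continuous_measurable_fun (@continuous_cos R))).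
by apply: measurable_funD => //; exact: dotp_measurable.
Qed.

(* Each vector a of s contributes an independent summand g a with g standard
   normal. *)
Lemma gaussian_sum k (s : seq 'rV[R]_k) :
  exists mu : probability (vecR R k) R, forall u th,
    \int[mu]_x cos (dotp u x + th) =
    cos th * expR (- ((\sum_(a <- s) dotp u a ^+ 2) / 2)).
Proof.
elim: s => [|a s [mu muE]].
  exists (\d_(0 : vecR R k)) => u th.
  rewrite big_nil mul0r oppr0 expR0 mulr1 /Rintegral integral_dirac//; last first.
    by apply/measurable_EFinP; exact: cos_dotp_measurable.
  by rewrite diracT mul1e/= dotp0r add0r.
pose nu := normal_prob (0 : R) 1.
pose f (z : vecR R k * measurableTypeR R) : vecR R k := (z.1 : 'rV[R]_k) + z.2 *: a.
have mf : measurable_fun setT f.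
  apply: vec_measurable => i; under eq_fun do rewrite !mxE.
  apply: measurable_funD; first exact: measurableT_comp (coord_measurable i) measurable_fst.
  by apply: measurable_funM => //; exact: measurable_snd.
pose X : {mfun _ >-> _} :=
  MeasurableFun.Pack (MeasurableFun.Class (isMeasurableFun.Build _ _ _ _ _ mf)).
pose Pm : probability _ R := (mu \x nu)%E.
exists (distribution Pm X) => u th.
have mc := cos_dotp_measurable u th.
rewrite -(@Int_law _ _ _ _ _ Pm f _ _ 1 mf _ mc); last 2 first.
- by [].
- by move=> x; exact: cos_max.
have mg : measurable_fun setT (fun z => cos (dotp u (f z) + th)).
  exact: (measurableT_comp mc mf).
have gi : L1 Pm (fun z => cos (dotp u (f z) + th)).
  by apply: (@L1_bounded _ _ _ _ _ 1) => // x; exact: cos_max.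
rewrite /Rintegral -(integral12_prod_meas1 gi).
(* The normal coordinate is integrated out first: [normal_cos] with phase [dotp u x + th] leaves a
   Gaussian factor times the integrand of the induction hypothesis. *)
transitivity (\int[mu]_x (expR (- (dotp u a ^+ 2 / 2)) * cos (dotp u x + th))).
  congr fine; apply: eq_integral => x _ /=; rewrite /fubini_F /=.
  rewrite -Int_EFin; last first.
    apply: (@L1_bounded _ _ _ _ _ 1) => [|y]; last exact: cos_max.
    by have := measurableT_comp mg (pair1_measurable x).
  congr EFin; rewrite mulrC -normal_cos; apply: eq_Rintegral => y _.
  by rewrite /f/= dotpDr dotpZr; congr cos; rewrite addrAC addrC mulrC.
rewrite IntZ; last first.
  by apply: (@L1_bounded _ _ _ _ _ 1) => // x; exact: cos_max.
by rewrite muE big_cons mulrC -mulrA -expRD; congr (_ * expR _); field.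
Qed.

Lemma centered_normal_exists k (W : 'M[R]_k) : W^T = W ->
  (forall u : 'rV_k, 0 <= (u *m W *m u^T) ord0 ord0) ->
  exists mu : probability (vecR R k) R, is_centered_normal mu W.
Proof.
move=> Wsym Wpsd; have [s sE] := psd_sum_squares Wsym Wpsd.
have [mu muE] := gaussian_sum s; exists mu => u; rewrite sE; split.
  transitivity (\int[mu]_x cos (dotp u x + 0)).
    by apply: eq_Rintegral => x _; rewrite addr0.
  by rewrite muE cos0 mul1r.
transitivity (\int[mu]_x cos (dotp u x - pi / 2)).
  by apply: eq_Rintegral => x _; rewrite cosBpihalf.
by rewrite muE cosN cos_pihalf mul0r.
Qed.

End gaussian.

(** * Approximation by trigonometric polynomials *)

Section bernstein.
Variable R : realType.
Implicit Types y : R.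

(* Probability that a binomial (N, y) variable equals c. *)
Fixpoint bern (N c : nat) y : R :=
  if N is N'.+1 then
    (1 - y) * bern N' c y + (if c is c'.+1 then y * bern N' c' y else 0)
  else (c == 0)%N%:R.

#[local] Arguments bern : simpl never.

Lemma bern_ge0 N c y : 0 <= y <= 1 -> 0 <= bern N c y.
Proof.
move=> /andP[y0 y1]; elim: N c => [|N IH] c; first by rewrite /bern ler0n.
rewrite /bern -/bern addr_ge0// ?mulr_ge0// ?subr_ge0//.
by case: c => // c; rewrite mulr_ge0.
Qed.

Lemma bern_gt N c y : (N < c)%N -> bern N c y = 0.
Proof.
elim: N c => [|N IH] [|c]// Nc.
by rewrite /bern -/bern !IH ?mulr0 ?addr0// ltnW.
Qed.

(** Conditioning on one more trial, a success moving the count to [c + 1]. Moments follow by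
    induction on [N] without binomial coefficients. *)
Lemma bern_step N y (g : nat -> R) :
  \sum_(c < N.+2) bern N.+1 c y * g c =
  \sum_(c < N.+1) bern N c y * (y * g c.+1 + (1 - y) * g c).
Proof.
transitivity (\sum_(c < N.+2) ((1 - y) * bern N c y * g c +
    (if c : nat is c'.+1 then y * bern N c' y else 0) * g c)).
  by apply: eq_bigr => c _; rewrite -mulrDl.
rewrite big_split /= [X in _ + X]big_ord_recl/= mul0r add0r big_ord_recr/=.
rewrite bern_gt// mulr0 mul0r addr0 -big_split/=; apply: eq_bigr => c _.
by rewrite /bump/= add1n; ring.
Qed.

Lemma bern_sum N y : \sum_(c < N.+1) bern N c y = 1.
Proof.
elim: N => [|N IH]; first by rewrite big_ord1.
under eq_bigr do rewrite -[bern _ _ _]mulr1.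
rewrite (bern_step N y (fun=> 1)) -[RHS]IH.
by apply: eq_bigr => c _; ring.
Qed.

(** Each further trial adds the variance [y * (1 - y)] of one Bernoulli variable, the cross terms
    cancelling. *)
Lemma bern_var0 N y :
  \sum_(c < N.+1) bern N c y * (c%:R - N%:R * y) ^+ 2 = N%:R * (y * (1 - y)).
Proof.
elim: N => [|N IH]; first by rewrite big_ord1/= !mul0r subrr expr0n mulr0.
rewrite (bern_step N y (fun c => (c%:R - N.+1%:R * y) ^+ 2)).
transitivity (\sum_(c < N.+1) (bern N c y * (c%:R - N%:R * y) ^+ 2
    + y * (1 - y) * bern N c y)).
  by apply: eq_bigr => c _; rewrite -!natr1; ring.
by rewrite big_split /= -mulr_sumr bern_sum IH -natr1; ring.
Qed.

Lemma bern_var N y : 0 <= y <= 1 ->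
  \sum_(c < N.+2) bern N.+1 c y * (c%:R / N.+1%:R - y) ^+ 2 <= N.+1%:R^-1.
Proof.
move=> /andP[y0 y1].
have N0 : N.+1%:R != 0 :> R by rewrite pnatr_eq0.
have -> : \sum_(c < N.+2) bern N.+1 c y * (c%:R / N.+1%:R - y) ^+ 2 =
  (y * (1 - y)) / N.+1%:R.
  transitivity (N.+1%:R ^- 2 * (N.+1%:R * (y * (1 - y)))); last first.
    by move: N.+1%:R N0 => n n0; field.
  rewrite -bern_var0 mulr_sumr; apply: eq_bigr => c _.
  by move: N.+1%:R N0 => n n0; field.
rewrite ler_piMl ?invr_ge0//; nra.
Qed.

End bernstein.

Section marginals.
Variables (R : comNzRingType) (I J : finType) (w : I -> J -> R).
Hypothesis w1 : forall i, \sum_j w i j = 1.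

Lemma prod_weights1 : \sum_(f : {ffun I -> J}) \prod_i w i (f i) = 1.
Proof. by rewrite -bigA_distr_bigA big1. Qed.

(** With [q] put into the [i]-th factor the summand is still a product, so the sum is a product of
    sums, all but the [i]-th equal to 1. This reduces the multivariate Bernstein variance to one
    coordinate. *)
Lemma prod_weights_marginal (q : J -> R) i :
  \sum_(f : {ffun I -> J}) (\prod_l w l (f l)) * q (f i) = \sum_j w i j * q j.
Proof.
pose w' l j := w l j * (if l == i then q j else 1).
transitivity (\sum_(f : {ffun I -> J}) \prod_l w' l (f l)).
  apply: eq_bigr => f _; rewrite /w' big_split/=; congr (_ * _).
  by rewrite -big_mkcond/= big_pred1_eq.
rewrite -bigA_distr_bigA (bigD1 i)//= [X in _ * X]big1 ?mulr1 => [|l li].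
  by apply: eq_bigr => j _; rewrite /w' eqxx.
by rewrite -[RHS](w1 l); apply: eq_bigr => j _; rewrite /w' (negbTE li) mulr1.
Qed.

End marginals.

Lemma continuous_bigsum (R : realType) (T : topologicalType) (I : Type) (s : seq I)
    (f : I -> T -> R) :
  (forall i, continuous (f i)) -> continuous (fun x => \sum_(i <- s) f i x).
Proof.
move=> cf; elim: s => [|i s IH] x.
  by under eq_fun do rewrite big_nil; exact: cvg_cst.
rewrite /continuous_at; under eq_fun do rewrite big_cons.
by rewrite big_cons; apply: cvgD; [exact: cf|exact: IH].
Qed.

Section trigonometric_polynomials.
Variables (R : realType) (k : nat).
Implicit Types f g : 'rV[R]_k -> R.

(** Products are not a constructor, so that convergence of integrals passes from sines and cosines
    to all of [trig] by linearity; [trigM] recovers products through the product-to-sum formulas. *)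
Inductive trig : ('rV[R]_k -> R) -> Prop :=
| trig_cos u : trig (fun x => cos (dotp u x))
| trig_sin u : trig (fun x => sin (dotp u x))
| trigD f g : trig f -> trig g -> trig (fun x => f x + g x)
| trigZ a f : trig f -> trig (fun x => a * f x).

Lemma trig_ext f g : f =1 g -> trig f -> trig g.
Proof. by move=> /funext ->. Qed.

Lemma trig_cst a : trig (fun=> a).
Proof.
apply: trig_ext (trigZ a (trig_cos 0)) => x.
by rewrite dotp0l cos0 mulr1.
Qed.

Lemma trigM f g : trig f -> trig g -> trig (fun x => f x * g x).
Proof.
move=> tf tg; elim: tf => [u|u|f1 f2 _ t1 _ t2|a f1 _ t1].
- elim: tg => [v|v|g1 g2 _ t1 _ t2|a g1 _ t1].
  + apply: trig_ext (trigZ (2^-1) (trigD (trig_cos (u + v)) (trig_cos (u - v)))).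
    by move=> x; rewrite dotpBl dotpDl cosB cosD; field.
  + apply: trig_ext (trigZ (2^-1) (trigD (trig_sin (u + v))
      (trigZ (-1) (trig_sin (u - v))))).
    by move=> x; rewrite dotpBl dotpDl sinB sinD; field.
  + by apply: trig_ext (trigD t1 t2) => x; rewrite mulrDr.
  + by apply: trig_ext (trigZ a t1) => x; rewrite mulrCA.
- elim: tg => [v|v|g1 g2 _ t1 _ t2|a g1 _ t1].
  + apply: trig_ext (trigZ (2^-1) (trigD (trig_sin (u + v)) (trig_sin (u - v)))).
    by move=> x; rewrite dotpBl dotpDl sinB sinD; field.
  + apply: trig_ext (trigZ (2^-1) (trigD (trig_cos (u - v))
      (trigZ (-1) (trig_cos (u + v))))).
    by move=> x; rewrite dotpBl dotpDl cosB cosD; field.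
  + by apply: trig_ext (trigD t1 t2) => x; rewrite mulrDr.
  + by apply: trig_ext (trigZ a t1) => x; rewrite mulrCA.
- by apply: trig_ext (trigD t1 t2) => x; rewrite mulrDl.
- by apply: trig_ext (trigZ a t1) => x; rewrite mulrA.
Qed.

Lemma trig_sum (I : Type) (s : seq I) (F : I -> 'rV[R]_k -> R) :
  (forall i, trig (F i)) -> trig (fun x => \sum_(i <- s) F i x).
Proof.
move=> tF; elim: s => [|i s IH].
  by apply: trig_ext (trig_cst 0) => x; rewrite big_nil.
by apply: trig_ext (trigD (tF i) IH) => x; rewrite big_cons.
Qed.

Lemma trig_prod (I : Type) (s : seq I) (F : I -> 'rV[R]_k -> R) :
  (forall i, trig (F i)) -> trig (fun x => \prod_(i <- s) F i x).
Proof.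
move=> tF; elim: s => [|i s IH].
  by apply: trig_ext (trig_cst 1) => x; rewrite big_nil.
by apply: trig_ext (trigM (tF i) IH) => x; rewrite big_cons.
Qed.

Lemma trig_bern N c (f : 'rV[R]_k -> R) :
  trig f -> trig (fun x => bern N c (f x)).
Proof.
move=> tf; elim: N c => [|N IH] c /=; first exact: trig_cst.
apply: trigD.
  apply: trigM => //; apply: trigD; first exact: trig_cst.
  by apply: trig_ext (trigZ (-1) tf) => x; rewrite mulN1r.
by case: c => [|c]; [exact: trig_cst|exact: trigM].
Qed.

Lemma trig_measurable f : trig f -> measurable_fun setT (f : vecR R k -> R).
Proof.
elim => [u|u|f1 f2 _ t1 _ t2|a f1 _ t1].
- apply: (measurableT_comp (continuous_measurable_fun (@continuous_cos R))).
  exact: dotp_measurable.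
- apply: (measurableT_comp (continuous_measurable_fun (@continuous_sin R))).
  exact: dotp_measurable.
- exact: measurable_funD.
- exact: measurable_funM.
Qed.

Let sin_scaleE (K : R) : 2 * K / pi * (pi / 2) = K.
Proof.
by rewrite mulrA divfK ?gt_eqF ?pi_gt0// mulrAC divff ?mul1r// pnatr_eq0.
Qed.

(** The pairs in the cube with [|F x - F y| >= e] form a compact set on which the sum of squares is
    positive, because [x / L] ranges over [[- pi / 2, pi / 2]], where [sin] is injective. Its
    minimum there yields [C]. Squares make the sum accessible to the Bernstein variance. *)
Lemma sin_separates_compact (F : 'rV[R]_k -> R) (M K e : R) :
  continuous F -> (forall x, `|F x| <= M) -> 0 < K -> 0 < e ->
  let L := 2 * K / pi in
  exists2 C, 0 <= C & forall x y : 'rV[R]_k,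
    (forall j, `|x ord0 j| <= K) -> (forall j, `|y ord0 j| <= K) ->
    `|F x - F y| <= e +
      C * \sum_j (sin (x ord0 j / L) - sin (y ord0 j / L)) ^+ 2.
Proof.
move=> cF FM K0 e0 L.
have L0 : 0 < L by rewrite divr_gt0 ?pi_gt0// mulr_gt0.
pose Q := [set x : 'rV[R]_k | forall j, `[-K, K]%classic (x ord0 j)].
have cQ : compact Q.
  apply: (@rV_compact _ _ (fun=> `[- K, K]%classic)) => j.
  exact: segment_compact.
pose D (z : 'rV[R]_k * 'rV[R]_k) := `|F z.1 - F z.2|.
pose E (z : 'rV[R]_k * 'rV[R]_k) :=
  \sum_j (sin (z.1 ord0 j / L) - sin (z.2 ord0 j / L)) ^+ 2.
have cD : continuous D.
  move=> z; apply: cvg_norm; apply: cvgB.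
    by apply: (cvg_comp fst F); [exact: cvg_fst|exact: cF].
  by apply: (cvg_comp snd F); [exact: cvg_snd|exact: cF].
have cs (j : 'I_k) : continuous (fun x : 'rV[R]_k => sin (x ord0 j / L)).
  have cj : continuous (fun x : 'rV[R]_k => x ord0 j) by exact: coord_continuous.
  have csin : continuous (fun r : R => sin (r / L)).
    by move=> r; exact/differentiable_continuous/derivable1_diffP.
  move=> x; exact: (@continuous_comp _ _ _ (fun x : 'rV[R]_k => x ord0 j)
    (fun r : R => sin (r / L)) x (cj x) (csin _)).
have cE : continuous E.
  apply: continuous_bigsum => j z.
  apply: (cvg_comp _ (fun r : R => r ^+ 2)); last exact: exprn_continuous.
  apply: cvgB.
    by apply: (cvg_comp fst (fun x : 'rV[R]_k => sin (x ord0 j / L)));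
      [exact: cvg_fst|exact: cs].
  by apply: (cvg_comp snd (fun x : 'rV[R]_k => sin (x ord0 j / L)));
    [exact: cvg_snd|exact: cs].
pose Z := (Q `*` Q) `&` D @^-1` [set r | e <= r].
have cZ : compact Z.
  apply: compact_closedI; first exact: compact_setX.
  by apply: preimage_closed => [z _|]; [exact: cD|exact: closed_ge].
have E_ge0 z : 0 <= E z by apply: sumr_ge0 => j _; rewrite sqr_ge0.
have QE (x : 'rV[R]_k) : (forall j, `|x ord0 j| <= K) -> Q x.
  by move=> xK j; rewrite /= in_itv/= -ler_norml.
have [Z0|/set0P Z0] := eqVneq Z set0.
  exists 0 => // x y xK yK; rewrite mul0r addr0 leNgt; apply/negP => h.
  have : Z (x, y) by split; [split; exact: QE|exact: ltW].
  by rewrite Z0.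
have [z /set_mem[[Qz1 Qz2] Dz] zmin] := compact_EVT_min Z0 cZ (continuous_subspaceT cE).
have Ez : 0 < E z.
  rewrite lt_def E_ge0 andbT; apply/eqP => Ez0.
  suff zz : z.1 = z.2 by move: Dz; rewrite /D /= zz subrr normr0 leNgt e0.
  apply/rowP => j.
  have /eqP : (sin (z.1 ord0 j / L) - sin (z.2 ord0 j / L)) ^+ 2 = 0.
    by move/psumr_eq0P : Ez0 => -> // i _; exact: sqr_ge0.
  rewrite sqrf_eq0 subr_eq0 => /eqP sE.
  have inI (x : R) : `[-K, K]%classic x -> x / L \in `[(- (pi / 2)), (pi / 2)].
    rewrite /= !in_itv/= => /andP[h1 h2].
    by rewrite ler_pdivlMr// ler_pdivrMr// mulNr [_ * L]mulrC sin_scaleE h1.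
  have := sin_inj (inI _ (Qz1 j)) (inI _ (Qz2 j)) sE.
  by move=> /(congr1 ( *%R^~ L)); rewrite !divfK ?gt_eqF.
have M0 : 0 <= M by rewrite (le_trans _ (FM 0)).
have C0 : 0 <= 2 * M / E z by rewrite divr_ge0 ?mulr_ge0// ltW.
exists (2 * M / E z) => //.
move=> x y xK yK; have [h|h] := leP e `|F x - F y|; last first.
  by rewrite (le_trans (ltW h))// lerDl mulr_ge0// (E_ge0 (x, y)).
have : E z <= E (x, y) by apply: zmin; apply/mem_set; split => //; split; exact: QE.
move=> Exy; apply: (@le_trans _ _ (2 * M)).
  by rewrite (le_trans (ler_normB _ _))// mulr2n mulrDl mul1r lerD.
rewrite (le_trans _ (_ : 2 * M / E z * E z <= _))//.
  by rewrite divfK// gt_eqF.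
by rewrite -[leLHS]add0r lerD ?(ltW e0)// ler_wpM2l.
Qed.

(* Bernstein polynomial in the variables (1 + sin (x_j / L)) / 2, which
   parametrise the cube |x_j| <= K when L = 2 K / pi. *)
Lemma trig_approx (F : 'rV[R]_k -> R) (M K e : R) :
  continuous F -> (forall x, `|F x| <= M) -> 0 < K -> 0 < e ->
  exists G : 'rV[R]_k -> R, [/\ trig G, forall x, `|G x| <= M &
    forall x : 'rV[R]_k, (forall j, `|x ord0 j| <= K) -> `|G x - F x| <= e].
Proof.
move=> cF FM K0 e0.
have [C C0 CF] := sin_separates_compact cF FM K0 (divr_gt0 e0 (ltr0n _ 2)).
move: CF; set L := 2 * K / pi => CF.
have L0 : 0 < L by rewrite divr_gt0 ?pi_gt0// mulr_gt0.
(* Each coordinate costs [C * 4 / (N + 1)]: the variance is at most [1 / (N + 1)], and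
   [sin = 2 * y - 1] doubles differences before squaring. This [N] keeps the total over [k]
   coordinates below [e / 2]. *)
pose N := Num.truncn (8 * C * k%:R / e).
have NC : C * (4 * k%:R) * N.+1%:R^-1 <= e / 2.
  rewrite ler_pdivrMr ?ltr0n//.
  have := truncnS_gt (8 * C * k%:R / e); rewrite -/N ltr_pdivrMr// => h.
  by apply: ltW; rewrite -subr_gt0; move: h; rewrite -subr_gt0 => h; nra.
pose y (x : 'rV[R]_k) j := (1 + sin (x ord0 j / L)) / 2.
have y01 x j : 0 <= y x j <= 1.
  by have := sin_geN1 (x ord0 j / L); have := sin_le1 (x ord0 j / L);
    rewrite /y => h1 h2; apply/andP; split; lra.
pose nd (f : {ffun 'I_k -> 'I_N.+2}) j : R := (f j : nat)%:R / N.+1%:R.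
(* The point of the cube at which the variables [y] take the grid values [nd f]. *)
pose node (f : {ffun 'I_k -> 'I_N.+2}) : 'rV[R]_k :=
  \row_j (L * asin (2 * nd f j - 1)).
pose w x (f : {ffun 'I_k -> 'I_N.+2}) := \prod_j bern N.+1 (f j) (y x j).
have w_ge0 x (f : {ffun 'I_k -> 'I_N.+2}) : 0 <= w x f by apply: prodr_ge0 => j _; exact: bern_ge0.
have w1 x : \sum_f w x f = 1.
  exact: (@prod_weights1 _ _ _ (fun j (c : 'I_N.+2) => bern N.+1 c (y x j))
    (fun j => bern_sum _ _)).
have node01 (f : {ffun 'I_k -> 'I_N.+2}) j : -1 <= 2 * nd f j - 1 <= 1.
  have h0 : 0 <= nd f j by rewrite divr_ge0.
  have h1 : nd f j <= 1 by rewrite ler_pdivrMr ?ltr0n// mul1r ler_nat -ltnS.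
  by apply/andP; split; lra.
exists (fun x => \sum_f w x f * F (node f)); split.
- apply: trig_sum => f; under eq_fun do rewrite mulrC; apply: trigZ.
  apply: trig_prod => j; apply: trig_bern.
  apply: trig_ext (trigZ (2^-1) (trigD (trig_cst 1)
    (trig_sin (L^-1 *: delta_mx ord0 j)))) => x.
  rewrite /y mulrC; congr ((1 + sin _) / 2).
  rewrite /dotp (bigD1 j)//= big1 => [|i ij]; last first.
    by rewrite !mxE (negbTE ij) andbF mulr0 mul0r.
  by rewrite !mxE !eqxx mulr1 addr0 mulrC.
(* A convex combination of values of [F] for every [x]: [y x j] lies in [[0, 1]] outside the cube
   too, so the weights are nonnegative there. *)
- move=> x; rewrite (le_trans (ler_norm_sum _ _ _))//.
  rewrite -[leRHS]mul1r -(w1 x) mulr_suml; apply: ler_sum => f _.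
  by rewrite normrM ger0_norm// ler_wpM2l.
move=> x xK.
have -> : \sum_f w x f * F (node f) - F x = \sum_f w x f * (F (node f) - F x).
  under [RHS]eq_bigr do rewrite mulrBr.
  by rewrite big_split/= sumrN -mulr_suml w1 mul1r.
rewrite (le_trans (ler_norm_sum _ _ _))//.
have nodeK (f : {ffun 'I_k -> 'I_N.+2}) j : `|node f ord0 j| <= K.
  rewrite -[leRHS]sin_scaleE -/L mxE normrM gtr0_norm// ler_wpM2l ?(ltW L0)// ler_norml.
  by rewrite asin_geNpi2 ?asin_lepi2.
have sn (f : {ffun 'I_k -> 'I_N.+2}) j : sin (node f ord0 j / L) - sin (x ord0 j / L) =
    2 * (nd f j - y x j).
  rewrite mxE mulrAC divff ?gt_eqF// mul1r asinK ?in_itv//=.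
  by rewrite /y; field.
apply: (@le_trans _ _ (\sum_f (w x f * (e / 2) +
    \sum_j C * 4 * (w x f * (nd f j - y x j) ^+ 2)))).
  apply: ler_sum => f _; rewrite normrM ger0_norm//.
  rewrite (le_trans (ler_wpM2l (w_ge0 x f) (CF _ _ (nodeK f) xK)))//.
  rewrite mulrDr lerD2l mulr_sumr mulr_sumr; apply: ler_sum => j _.
  by rewrite sn le_eqVlt; apply/orP; left; apply/eqP; ring.
rewrite big_split/= -mulr_suml w1 mul1r exchange_big/=.
rewrite [leRHS](splitr e) lerD2l (le_trans _ NC)//.
rewrite (_ : C * _ * _ = \sum_(j < k) C * 4 * N.+1%:R^-1); last first.
  by rewrite sumr_const card_ord -[RHS]mulr_natr; ring.
apply: ler_sum => j _; rewrite -mulr_sumr ler_wpM2l ?mulr_ge0//.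
rewrite (@prod_weights_marginal _ _ _ (fun j (c : 'I_N.+2) => bern N.+1 c (y x j))
    (fun j => bern_sum _ _) (fun c : 'I_N.+2 => ((c : nat)%:R / N.+1%:R - y x j) ^+ 2)).
exact: bern_var.
Qed.

(** The sigma-algebra is generated by coordinates and not by open sets, so continuity does not give
    measurability at once. Approximation on growing cubes makes [F] a pointwise limit of [trig]
    functions. *)
Lemma continuous_vec_measurable (F : 'rV[R]_k -> R) (M : R) :
  continuous F -> (forall x, `|F x| <= M) ->
  measurable_fun setT (F : vecR R k -> R).
Proof.
move=> cF FM.
have /choice[G GP] (n : nat) : exists G : 'rV[R]_k -> R,
    [/\ trig G, forall x, `|G x| <= M & forall x : 'rV[R]_k,
      (forall j, `|x ord0 j| <= n.+1%:R) -> `|G x - F x| <= n.+1%:R^-1].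
  by apply: trig_approx.
apply: (@measurable_fun_cvg _ _ _ _ (fun n => G n : vecR R k -> R)).
  by move=> n; apply: trig_measurable; case: (GP n).
move=> x _; apply/cvgrPdist_le => e e0; near=> n.
have xb j : `|x ord0 j| <= \sum_i `|x ord0 i|.
  by rewrite (bigD1 j)//= lerDl sumr_ge0.
have [_ _ GF] := GP n.
rewrite distrC (le_trans (GF x _))// => [j|].
  rewrite (le_trans (xb j))// (@le_trans _ _ n%:R) ?ler_nat//.
  by near: n; exact: nbhs_infty_ger.
rewrite invf_ple ?posrE// (@le_trans _ _ n%:R) ?ler_nat//.
by near: n; exact: nbhs_infty_ger.
Unshelve. all: by end_near. Qed.

End trigonometric_polynomials.

(** * Convergence in distribution from characteristic functions *)

Section levy_continuity.
Variables (R : realType) (k : nat).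

Definition outside (K : R) : set (vecR R k) :=
  [set x | exists j, K < `|(x : 'rV[R]_k) ord0 j|].

Lemma outside_measurable K : measurable (outside K).
Proof.
have -> : outside K = \bigcup_(j in [set: 'I_k])
    ((fun x : vecR R k => `|(x : 'rV[R]_k) ord0 j|) @^-1` `]K, +oo[%classic).
  apply/seteqP; split => x /=.
    by move=> [j Kj]; exists j => //=; rewrite in_itv/= Kj.
  by move=> [j _]; rewrite /= in_itv/= andbT => Kj; exists j.
apply: fin_bigcup_measurable => // j _; rewrite -[X in measurable X]setTI.
have mj : measurable_fun setT (fun x : vecR R k => `|(x : 'rV[R]_k) ord0 j|).
  exact: measurableT_comp (@normr_measurable R setT) (coord_measurable j).
by apply: mj => //; exact: measurable_itv.
Qed.

Lemma outside_le K K' : K <= K' -> outside K' `<=` outside K.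
Proof. by move=> KK x [j Kj]; exists j; exact: le_lt_trans Kj. Qed.

Lemma outside_tight (mu : probability (vecR R k) R) (e : R) : 0 < e ->
  exists K, fine (mu (outside K)) <= e.
Proof.
move=> e0.
have cv : mu (outside n%:R) @[n --> \oo] --> mu (\bigcap_n outside n%:R).
  apply: (@nonincreasing_cvg_mu _ _ _ mu (fun n => outside n%:R)).
  - by rewrite (le_lt_trans (probability_le1 _ (outside_measurable _))) ?ltry.
  - by move=> n; exact: outside_measurable.
  - by apply: bigcapT_measurable => n; exact: outside_measurable.
  - move=> m n mn; apply/subsetPset; apply: outside_le.
    by rewrite ler_nat.
have capE : \bigcap_n outside n%:R = set0 :> set (vecR R k).
  apply/seteqP; split => // x /=.
  pose b := \sum_j `|(x : 'rV[R]_k) ord0 j|.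
  move=> /(_ (Num.truncn b).+1 I)[j]; apply/negP; rewrite -leNgt.
  apply: le_trans (ltW (truncnS_gt b)).
  by rewrite /b (bigD1 j)//= lerDl sumr_ge0.
rewrite capE measure0 in cv.
have /fine_cvgP[_ /cvgr0_norm_le] := cv.
move=> /(_ _ e0)[N _ /(_ N (leqnn N))]/= h.
by exists N%:R; rewrite (le_trans (ler_norm _) h).
Qed.

(** Stated for an image under [Z], so that it serves [Y n] under [P] and, with [Z = id], the limit
    law. *)
Lemma integral_close d (T : measurableType d) (P : probability T R)
    (Z : T -> vecR R k) (f g : vecR R k -> R) (M e K : R) :
  measurable_fun setT Z -> measurable_fun setT f -> measurable_fun setT g ->
  (forall x, `|f x| <= M) -> (forall x, `|g x| <= M) -> 0 <= e ->
  (forall x, ~ outside K x -> `|f x - g x| <= e) ->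
  `|\int[P]_w f (Z w) - \int[P]_w g (Z w)| <=
    e + 2 * M * fine (P (Z @^-1` outside K)).
Proof.
move=> mZ mf mg fM gM e0 fg.
have fi : L1 P (fun w => f (Z w)).
  by apply: (@L1_bounded _ _ _ _ _ M) => //; exact: measurableT_comp.
have gi : L1 P (fun w => g (Z w)).
  by apply: (@L1_bounded _ _ _ _ _ M) => //; exact: measurableT_comp.
have mo : measurable (Z @^-1` outside K).
  by rewrite -[X in measurable X]setTI; apply: mZ => //; exact: outside_measurable.
have oi : L1 P (\1_(Z @^-1` outside K) : T -> R) by exact: integrable_indic.
rewrite -IntB// -[X in X + _](Int_cst P) -Int_indic// -IntZ// -IntD//; last 2 first.
- exact: L1_cst.
- exact: L1Z.
apply: Int_norm_le => [||w].
- exact: L1B.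
- by apply: L1D; [exact: L1_cst|exact: L1Z].
rewrite indicE; have [ow|ow] := boolP (w \in _).
  rewrite mulr1 (le_trans (ler_normB _ _))// -[leLHS]add0r lerD//.
  by rewrite mulr2n mulrDl mul1r lerD.
by rewrite mulr0 addr0 fg// => ho; move/negP: ow; apply; apply/mem_set.
Qed.

(** [f] is replaced by a [trig] function with the same bound [M], so the error outside a large cube
    is controlled by the tail probability alone. Tightness is a hypothesis because the application
    obtains it directly from second moments. *)
Lemma levy_continuity d (T : measurableType d) (P : probability T R)
    (Y : nat -> T -> 'rV[R]_k) (mu : probability (vecR R k) R) :
  (forall n, measurable_fun setT (Y n : T -> vecR R k)) ->
  (forall u, \int[P]_w cos (dotp u (Y n w)) @[n --> \oo] -->
    \int[mu]_x cos (dotp u x)) ->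
  (forall u, \int[P]_w sin (dotp u (Y n w)) @[n --> \oo] -->
    \int[mu]_x sin (dotp u x)) ->
  (forall e, 0 < e -> exists K, \forall n \near \oo,
    fine (P ((Y n : T -> vecR R k) @^-1` outside K)) <= e) ->
  cvg_distr P Y mu.
Proof.
move=> mY Ycos Ysin Ytight f cf [M fM].
have M0 : 0 <= M by rewrite (le_trans _ (fM 0)).
have trig_bounded (g : 'rV[R]_k -> R) : trig g -> exists B, forall x, `|g x| <= B.
  elim => [u|u|f1 f2 _ [B1 h1] _ [B2 h2]|a f1 _ [B1 h1]].
  - by exists 1 => x; exact: cos_max.
  - by exists 1 => x; exact: sin_max.
  - by exists (B1 + B2) => x; rewrite (le_trans (ler_normD _ _))// lerD.
  - by exists (`|a| * B1) => x; rewrite normrM ler_wpM2l.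
have trig_L1 (g : 'rV[R]_k -> R) d' (T' : measurableType d') (P' : probability T' R)
    (Z : T' -> vecR R k) : measurable_fun setT Z -> trig g ->
    L1 P' (fun w => g (Z w)).
  move=> mZ tg; have [B gB] := trig_bounded g tg.
  apply: (@L1_bounded _ _ _ _ _ B) => //.
  exact: (measurableT_comp (trig_measurable tg) mZ).
have trig_cvg (g : 'rV[R]_k -> R) : trig g ->
    \int[P]_w g (Y n w) @[n --> \oo] --> \int[mu]_x g x.
  elim => [u|u|f1 f2 t1 c1 t2 c2|a f1 t1 c1]; [exact: Ycos|exact: Ysin| |].
  - rewrite IntD; [|exact: (trig_L1 _ _ _ _ id)|exact: (trig_L1 _ _ _ _ id)].
    rewrite (_ : (fun n => _) = (fun n => \int[P]_w f1 (Y n w) + \int[P]_w f2 (Y n w))).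
      exact: cvgD.
    by apply/funext => n; rewrite IntD//;
      [exact: (trig_L1 _ _ _ _ (Y n))|exact: (trig_L1 _ _ _ _ (Y n))].
  - rewrite IntZ; last exact: (trig_L1 _ _ _ _ id).
    rewrite (_ : (fun n => _) = (fun n => a * \int[P]_w f1 (Y n w))).
      by apply: cvgM => //; exact: cvg_cst.
    by apply/funext => n; rewrite IntZ//; exact: (trig_L1 _ _ _ _ (Y n)).
have mf := continuous_vec_measurable cf fM.
apply/cvgrPdist_le => e e0.
(* Two replacements of [f] by [G] cost [e1 + 2 * M * e1] each and the convergence for [G] costs
   [e1]; the remaining [2 * e1] are slack. *)
pose e1 := e / (5 + 4 * M).
have D0 : 0 < 5 + 4 * M by rewrite ltr_wpDr// mulr_ge0.
have e10 : 0 < e1 by rewrite divr_gt0.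
have [K1 YK1] := Ytight _ e10.
have [K2 muK2] := outside_tight mu e10.
pose K := Num.max 1 (Num.max K1 K2).
have K0 : 0 < K by rewrite lt_max ltr01.
have [G [tG GM Gf]] := trig_approx cf fM K0 e10.
have mG := trig_measurable tG.
have Gf' x : ~ outside K x -> `|f x - G x| <= e1.
  move=> nx; rewrite distrC; apply: Gf => j; rewrite leNgt; apply/negP => h.
  by apply: nx; exists j.
have mle d' (T' : measurableType d') (P' : probability T' R) (Z : T' -> vecR R k) K' :
    measurable_fun setT Z -> K' <= K ->
    fine (P' (Z @^-1` outside K)) <= fine (P' (Z @^-1` outside K')).
  move=> mZ KK; have mo L : measurable (Z @^-1` outside L).
    by rewrite -[X in measurable X]setTI; apply: mZ => //; exact: outside_measurable.
  apply: fine_le; [exact: fin_num_measure|exact: fin_num_measure|].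
  apply: le_measure; [exact/mem_set/mo|exact/mem_set/mo|].
  by move=> w; exact: outside_le.
have hmu := @integral_close _ _ mu id f G M e1 K (@measurable_id _ _ _) mf mG fM GM (ltW e10) Gf'.
have hmu2 : fine (mu (outside K)) <= e1.
  apply: le_trans muK2; apply: (mle _ _ _ id) => //.
  by rewrite /K !le_max lexx !orbT.
have := trig_cvg G tG => /cvgrPdist_le/(_ _ e10) GY.
near=> n.
have hY := @integral_close _ _ P (Y n) f G M e1 K (mY n) mf mG fM GM (ltW e10) Gf'.
have hY2 : fine (P ((Y n : T -> vecR R k) @^-1` outside K)) <= e1.
  apply: (@le_trans _ _ (fine (P ((Y n : T -> vecR R k) @^-1` outside K1)))).
    by apply: mle; rewrite // /K !le_max lexx !orbT.
  by near: n.
have hG : `|\int[mu]_x G x - \int[P]_w G (Y n w)| <= e1 by near: n.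
have eE : e = e1 + 2 * M * e1 + e1 + (e1 + 2 * M * e1) + e1 + e1.
  by rewrite -[LHS](divfK (lt0r_neq0 D0)) -/e1; ring.
have h1 := ler_wpM2l (mulr_ge0 (ler0n R 2) M0) hmu2.
have h2 := ler_wpM2l (mulr_ge0 (ler0n R 2) M0) hY2.
rewrite eE.
have -> : \int[mu]_x f x - \int[P]_w f (Y n w) =
  (\int[mu]_x f x - \int[mu]_x G x) + (\int[mu]_x G x - \int[P]_w G (Y n w))
  - (\int[P]_w f (Y n w) - \int[P]_w G (Y n w)) by ring.
rewrite (le_trans (ler_normB _ _))// (le_trans (lerD (ler_normD _ _) (lexx _)))//.
rewrite (le_trans (lerD (lerD hmu hG) hY))//.
by move: h1 h2; rewrite preimage_id; lra.
Unshelve. all: by end_near. Qed.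

End levy_continuity.

(** * Independence and the central limit theorem *)

Section iid.
Variables (R : realType) (k : nat) (d : measure_display) (T : measurableType d).
Variables (P : probability T R) (F : probability (vecR R k) R).
Variable X : nat -> T -> vecR R k.
Hypothesis iidX : iid_with P X F.
Local Notation V := (vecR R k).

Let mX i : measurable_fun setT (X i). Proof. by case: iidX. Qed.

Lemma iid_law i (g : V -> R) M : measurable_fun setT g -> (forall x, `|g x| <= M) ->
  \int[P]_w g (X i w) = \int[F]_x g x.
Proof. move=> mg gM; case: iidX => _ lawX _.
exact: (Int_law (mX i) (lawX i) mg gM). Qed.

Lemma iid_indic n (B : nat -> set V) : (forall i, measurable (B i)) ->
  \int[P]_w (\prod_(i < n) \1_(B i) (X i w)) = \prod_(i < n) \int[F]_x \1_(B i) x.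
Proof.
move=> mB; pose I := seq_fset tt (iota 0 n).
have mC : measurable (\bigcap_(i in [set` I]) (X i @^-1` B i)).
  apply: fin_bigcap_measurable; first exact: finite_fset.
  by move=> i _; rewrite -[Y in measurable Y]setTI; exact: mX.
have IE : perm_eq (enum_fset I) (index_iota 0 n).
  apply: uniq_perm; [exact: fset_uniq|exact: iota_uniq|].
  by move=> i; rewrite seq_fsetE /index_iota subn0.
transitivity (\int[P]_w \1_(\bigcap_(i in [set` I]) (X i @^-1` B i)) w).
  apply: eq_Rintegral => w _; rewrite indicE.
  have [wI|wI] := boolP (w \in _).
    rewrite big1// => i _; rewrite indicE mem_set//.
    move/set_mem : wI => /(_ i); apply.
    by rewrite /= seq_fsetE mem_iota/= add0n.
  have [i iI Bi] : exists2 i : 'I_n, true & ~ B i (X i w).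
    apply: contrapT => h; move/negP : wI; apply; apply/mem_set => i /=.
    rewrite seq_fsetE mem_iota/= add0n => ilt; apply: contrapT => hB.
    by apply: h; exists (Ordinal ilt).
  by rewrite (bigD1 i)//= indicE memNset ?mul0r.
rewrite Int_indic//; case: iidX => _ lawX -> //.
rewrite (perm_big _ IE) big_mkord.
rewrite (_ : (\prod_(i < n) _)%E = (\prod_(i < n) \int[F]_x \1_(B i) x)%:E)//.
elim/big_ind2 : _ => // [x a y b -> ->|i _]; first by rewrite EFinM.
by rewrite lawX// Int_indic// fineK// fin_num_measure.
Qed.

(** The factors are changed one at a time from indicators to bounded functions: [bounded_extension]
    acts on one factor with the product of the others as weight, and [iid_indic] starts the
    induction. *)
Lemma iid_prod n (g : nat -> V -> R) (M : R) :
  (forall i, measurable_fun setT (g i)) -> (forall i x, `|g i x| <= M) ->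
  \int[P]_w (\prod_(i < n) g i (X i w)) = \prod_(i < n) \int[F]_x g i x.
Proof.
move=> mg gM.
suff H m (h : nat -> V -> R) : (m <= n)%N -> (forall i, measurable_fun setT (h i)) ->
    (exists M', forall i x, `|h i x| <= M') ->
    (forall i, (m <= i)%N -> exists2 B, measurable B & h i = \1_B) ->
    \int[P]_w (\prod_(i < n) h i (X i w)) = \prod_(i < n) \int[F]_x h i x.
  (* The induction asks for an indicator at every index from [m] on, hence a filler beyond the [n]
     factors. *)
  pose h i := if (i < n)%N then g i else \1_set0.
  have hE i : (i < n)%N -> h i = g i by rewrite /h => ->.
  transitivity (\int[P]_w (\prod_(i < n) h i (X i w))).
    by apply: eq_Rintegral => w _; apply: eq_bigr => i _; rewrite hE.
  rewrite (H n) => // [|i||i ni].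
  - by apply: eq_bigr => i _; rewrite hE.
  - by rewrite /h; case: ifP.
  - exists (Num.max M 1) => i x; rewrite /h le_max; case: ifP => _.
      by rewrite gM.
    by rewrite indicE in_set0 normr0 ler01 orbT.
  - by rewrite /h ltnNge ni/=; exists set0.
elim: m h => [|m IH] h mn mh [M' hM'] hB.
  have /choice[B BP] i : exists B, measurable B /\ h i = \1_B.
    by have [B mB hE] := hB i isT; exists B.
  transitivity (\int[P]_w (\prod_(i < n) \1_(B i) (X i w))).
    by apply: eq_Rintegral => w _; apply: eq_bigr => i _; rewrite (BP i).2.
  rewrite iid_indic => [|i]; last by case: (BP i).
  by apply: eq_bigr => i _; rewrite (BP i).2.
pose j := Ordinal mn.
pose H w := \prod_(i < n | i != j) h i (X i w).
pose c := \prod_(i < n | i != j) \int[F]_x h i x.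
have mH : measurable_fun setT H.
  have -> : H = fun w => \prod_(i <- [seq i <- index_enum 'I_n | i != j]) h i (X i w).
    by apply/funext => w; rewrite big_filter.
  by apply: measurable_prod => i _; exact: measurableT_comp (mh i) (mX i).
have HM w : `|H w| <= \prod_(i < n | i != j) M'.
  by rewrite normr_prod; apply: ler_prod => i _; rewrite normr_ge0 hM'.
transitivity (\int[P]_w (H w * h m (X m w))).
  by apply: eq_Rintegral => w _; rewrite (bigD1 j)//= mulrC.
rewrite (@bounded_extension _ _ _ _ _ _ _ P F H (X m) (cst c) id (h m) M')//.
- rewrite [RHS](bigD1 j)//= [RHS]mulrC -/c.
  exact: (IntZ c (L1_bounded F (mh m) (hM' m))).
- exact: L1_bounded HM.
- exact: L1_cst.
move=> B mB; pose hb i := if i == m then \1_B : V -> R else h i.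
transitivity (\int[P]_w (\prod_(i < n) hb i (X i w))).
  apply: eq_Rintegral => w _; rewrite [RHS](bigD1 j)//= /hb eqxx mulrC; congr (_ * _).
  by apply: eq_bigr => i ij; rewrite ifF//; apply: contraNF ij => /eqP ij; apply/eqP/val_inj.
rewrite IH.
- rewrite [LHS](bigD1 j)//= /hb eqxx [LHS]mulrC.
  rewrite [RHS](IntZ c (integrable_indic F mB)); congr (_ * _).
  by apply: eq_bigr => i ij; rewrite ifF//; apply: contraNF ij => /eqP ij; apply/eqP/val_inj.
- exact: ltnW.
- by move=> i; rewrite /hb; case: ifP.
- exists (Num.max M' 1) => i x; rewrite /hb le_max; case: ifP => _; last by rewrite hM'.
  by rewrite indicE ger0_norm// -[1]/(1%:R) ler_nat leq_b1 orbT.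
- move=> i mi; rewrite /hb; case: eqP => [_|/eqP im]; first by exists B.
  by apply: hB; rewrite ltn_neqAle eq_sym im.
Qed.

Lemma iid_pair i j (g h : V -> R) (M : R) : i != j ->
  measurable_fun setT g -> measurable_fun setT h ->
  (forall x, `|g x| <= M) -> (forall x, `|h x| <= M) ->
  \int[P]_w (g (X i w) * h (X j w)) = (\int[F]_x g x) * \int[F]_x h x.
Proof.
move=> ij mg mh gM hM.
pose f l := if l == i then g else if l == j then h else cst 1.
pose n := (maxn i j).+1.
have il : (i < n)%N by rewrite ltnS leq_maxl.
have jl : (j < n)%N by rewrite ltnS leq_maxr.
have fE (G : nat -> (V -> R) -> R) : (forall l, G l (cst 1) = 1) ->
    \prod_(l < n) G l (f l) = G i g * G j h.
  move=> G1; rewrite (bigD1 (Ordinal il))//= /f eqxx; congr (_ * _).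
  rewrite (bigD1 (Ordinal jl))/=; last by rewrite -val_eqE/= eq_sym.
  rewrite eq_sym (negbTE ij) eqxx big1 ?mulr1// => l.
  by rewrite -!val_eqE/= => /andP[/negbTE -> /negbTE ->].
transitivity (\int[P]_w (\prod_(l < n) f l (X l w))).
  apply: eq_Rintegral => w _.
  by rewrite (fE (fun l u => u (X l w))).
rewrite (@iid_prod _ _ (Num.max M 1)).
- by rewrite (fE (fun _ u => \int[F]_x u x))// => _; rewrite Int_cst.
- by move=> l; rewrite /f; case: ifP => // _; case: ifP.
- move=> l x; rewrite /f le_max; case: ifP => _; first by rewrite gM.
  case: ifP => _; first by rewrite hM.
  by rewrite normr1 lexx orbT.
Qed.

Lemma iid_sum_sqr n (g : V -> R) (M : R) : measurable_fun setT g ->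
  (forall x, `|g x| <= M) -> \int[F]_x g x = 0 ->
  \int[P]_w (\sum_(i < n) g (X i w)) ^+ 2 = n%:R * \int[F]_x (g x ^+ 2).
Proof.
move=> mg gM g0.
have M0 : 0 <= M by apply: le_trans (gM 0).
have mgX i : measurable_fun setT (fun w => g (X i w)) by exact: measurableT_comp.
have pL i j : L1 P (fun w => g (X i w) * g (X j w)).
  apply: (@L1_bounded _ _ _ _ _ (M * M)) => [|w]; first exact: measurable_funM.
  by rewrite normrM ler_pM.
transitivity (\int[P]_w (\sum_(i < n) \sum_(j < n) g (X i w) * g (X j w))).
  apply: eq_Rintegral => w _; rewrite expr2 mulr_suml; apply: eq_bigr => i _.
  by rewrite mulr_sumr.
rewrite Int_sum => [|i]; last exact: L1_sum.
rewrite -[in RHS](card_ord n) -sum1_card natr_sum mulr_suml; apply: eq_bigr => i _.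
rewrite mul1r Int_sum// (bigD1 i)//= big1 ?addr0 => [|j ji].
  rewrite -(@iid_law i _ (M ^+ 2)).
  - by apply: eq_Rintegral => w _; rewrite expr2.
  - exact: measurable_funX.
  - by move=> x; rewrite normrX lerXn2r// nnegrE.
by rewrite (iid_pair _ mg mg gM gM) ?g0 ?mul0r// eq_sym.
Qed.

(** * Scalar central limit theorem for bounded centred summands *)

Section clt.
Variables (g : V -> R) (B : R).
Hypotheses (mg : measurable_fun setT g) (gB : forall x, `|g x| <= B).
Hypothesis g0 : \int[F]_x g x = 0.
Let s2 := \int[F]_x (g x ^+ 2).
(** Error per summand: [2 * B ^+ 4] from [int_cos], whose [r ^+ 4] is at most [r ^+ 3] when
    [r <= 1], and [B ^+ 3] from [int_sin]. *)
Let K := 2 * B ^+ 4 + B ^+ 3.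

Let B0 : 0 <= B. Proof. exact: le_trans (gB 0). Qed.

(** The induction needs all phases at once: the addition formula produces a sine of the sum, which
    is a cosine with phase [th - pi / 2]. *)
Let cosC (r th : R) (n : nat) := \int[P]_w cos (th + r * \sum_(i < n) g (X i w)).

Let mS n : measurable_fun setT (fun w => \sum_(i < n) g (X i w)).
Proof. by apply: measurable_sum => i; exact: measurableT_comp. Qed.

Let mcosS r th n : measurable_fun setT (fun w => cos (th + r * \sum_(i < n) g (X i w))).
Proof.
apply: (measurableT_comp (continuous_measurable_fun (@continuous_cos R))).
by apply: measurable_funD => //; exact: measurable_funM.
Qed.

Let mcg r : measurable_fun setT (fun x => cos (r * g x)).
Proof.
apply: (measurableT_comp (continuous_measurable_fun (@continuous_cos R))).
exact: measurable_funM.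
Qed.

Let msg r : measurable_fun setT (fun x => sin (r * g x)).
Proof.
apply: (measurableT_comp (continuous_measurable_fun (@continuous_sin R))).
exact: measurable_funM.
Qed.

(** The cosine of a sum is not a product, so [iid_prod] does not apply to it directly. The addition
    formula peels off the last summand as a factor [cos (r * g)] or [sin (r * g)], which is stored
    in the free slot [h m = cst 1]. *)
Let cosC_indep r n m (h : nat -> V -> R) th : (m <= n)%N ->
  (forall i, measurable_fun setT (h i)) -> (forall i x, `|h i x| <= 1) ->
  (forall i, (i < m)%N -> h i = cst 1) ->
  \int[P]_w (cos (th + r * \sum_(i < m) g (X i w)) * \prod_(i < n) h i (X i w)) =
  cosC r th m * \prod_(i < n) \int[F]_x h i x.
Proof.
elim: m h th => [|m IH] h th mn mh h1 hc.
  rewrite /cosC; under [in RHS]eq_Rintegral do rewrite big_ord0 mulr0 addr0.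
  under [LHS]eq_Rintegral do rewrite big_ord0 mulr0 addr0.
  rewrite Int_cst IntZ ?(iid_prod _ mh h1)//.
  apply: (@L1_bounded _ _ _ _ _ 1) => [|w].
    by apply: measurable_prod => i _; exact: measurableT_comp.
  rewrite normr_prod; have := @ler_prod R 'I_n (index_enum _) xpredT
    (fun i => `|h i (X i w)|) (fun=> 1).
  by rewrite big1_eq; apply => i _; rewrite normr_ge0 h1.
pose hh (h : nat -> V -> R) (f : V -> R) i := if i == m then f else h i.
have step (h' : nat -> V -> R) (f : V -> R) t :
    (forall i, measurable_fun setT (h' i)) -> (forall i x, `|h' i x| <= 1) ->
    (forall i, (i < m.+1)%N -> h' i = cst 1) ->
    measurable_fun setT f -> (forall x, `|f x| <= 1) ->
    \int[P]_w (cos (t + r * \sum_(i < m) g (X i w)) * (f (X m w) * \prod_(i < n) h' i (X i w)))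
    = cosC r t m * ((\int[F]_x f x) * \prod_(i < n) \int[F]_x h' i x).
  move=> mh' h1' hc' mf f1; pose j := Ordinal mn.
  have hhE (G : nat -> (V -> R) -> R) : (forall l, G l (cst 1) = 1) ->
      \prod_(i < n) G i (hh h' f i) = G m f * \prod_(i < n) G i (h' i).
    move=> G1; rewrite (bigD1 j)//= [in RHS](bigD1 j)//= (hc' m)// G1 mul1r.
    rewrite /hh eqxx; congr (_ * _); apply: eq_bigr => i ij.
    by rewrite ifF//; apply: contraNF ij => /eqP ij; apply/eqP/val_inj.
  rewrite -(hhE (fun _ u => \int[F]_x u x)) => [|_]; last by rewrite Int_cst.
  rewrite -IH.
  - apply: eq_Rintegral => w _; congr (_ * _).
    by rewrite (hhE (fun i u => u (X i w))).
  - exact: ltnW.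
  - by move=> i; rewrite /hh; case: ifP.
  - by move=> i x; rewrite /hh; case: ifP.
  - by move=> i im; rewrite /hh ltn_eqF// hc'// ltnW.
have expand w : cos (th + r * \sum_(i < m.+1) g (X i w)) =
    cos (th + r * \sum_(i < m) g (X i w)) * cos (r * g (X m w)) -
    cos (th - pi / 2 + r * \sum_(i < m) g (X i w)) * sin (r * g (X m w)).
  rewrite big_ord_recr/= mulrDr addrA cosD; congr (_ - _ * _).
  by rewrite addrAC cosBpihalf.
have L (f : V -> R) t (h' : nat -> V -> R) : measurable_fun setT f -> (forall x, `|f x| <= 1) ->
    (forall i, measurable_fun setT (h' i)) -> (forall i x, `|h' i x| <= 1) ->
    L1 P (fun w => cos (t + r * \sum_(i < m) g (X i w)) *
      (f (X m w) * \prod_(i < n) h' i (X i w))).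
  move=> mf f1 mh' h1'; apply: (@L1_bounded _ _ _ _ _ 1) => [|w].
    apply: measurable_funM => //; apply: measurable_funM.
      exact: measurableT_comp.
    by apply: measurable_prod => i _; exact: measurableT_comp.
  rewrite !normrM normr_prod mulr_ile1 ?cos_max ?mulr_ge0// ?prodr_ge0//.
  rewrite mulr_ile1 ?prodr_ge0//; have := @ler_prod R 'I_n (index_enum _) xpredT
    (fun i => `|h' i (X i w)|) (fun=> 1).
  by rewrite big1_eq; apply => i _; rewrite normr_ge0 h1'.
have main (h' : nat -> V -> R) : (forall i, measurable_fun setT (h' i)) ->
    (forall i x, `|h' i x| <= 1) -> (forall i, (i < m.+1)%N -> h' i = cst 1) ->
    \int[P]_w (cos (th + r * \sum_(i < m.+1) g (X i w)) * \prod_(i < n) h' i (X i w)) =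
    (cosC r th m * \int[F]_x cos (r * g x) -
     cosC r (th - pi / 2) m * \int[F]_x sin (r * g x)) * \prod_(i < n) \int[F]_x h' i x.
  move=> mh' h1' hc'.
  rewrite mulrBl -!mulrA -(step h' (fun x => cos (r * g x)))// => [|x]; last exact: cos_max.
  rewrite -(step h' (fun x => sin (r * g x)))// => [|x]; last exact: sin_max.
  rewrite -IntB.
  - by apply: eq_Rintegral => w _; rewrite expand mulrBl !mulrA.
  - by apply: (L (fun x => cos (r * g x))) => // x; exact: cos_max.
  - by apply: (L (fun x => sin (r * g x))) => // x; exact: sin_max.
rewrite main//; congr (_ * _).
(* With trivial factors, [main] identifies the bracket as [cosC r th m.+1]. *)
have := main (fun=> cst 1) (fun=> measurable_cst _) (fun _ _ => _) (fun _ _ => erefl).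
rewrite [X in _ * X]big1 => [|i _]; last by rewrite Int_cst.
rewrite mulr1 => <- //; last by move=> ? ?; rewrite normr1.
by apply: eq_Rintegral => w _; rewrite [X in _ * X]big1 ?mulr1.
Qed.

Let cosC_step r n th : cosC r th n.+1 =
  cosC r th n * \int[F]_x cos (r * g x) - cosC r (th - pi / 2) n * \int[F]_x sin (r * g x).
Proof.
have c t (f : V -> R) : measurable_fun setT f -> (forall x, `|f x| <= 1) ->
    \int[P]_w (cos (t + r * \sum_(i < n) g (X i w)) * f (X n w)) =
    cosC r t n * \int[F]_x f x.
  move=> mf f1; pose h i := if i == n then f else cst 1.
  have hE (G : nat -> (V -> R) -> R) : (forall l, G l (cst 1) = 1) ->
      \prod_(i < n.+1) G i (h i) = G n f.
    move=> G1; rewrite big_ord_recr/= /h eqxx big1 ?mul1r// => i _.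
    by rewrite ltn_eqF.
  rewrite -(hE (fun _ u => \int[F]_x u x)) => [|_]; last by rewrite Int_cst.
  rewrite -cosC_indep.
  - by apply: eq_Rintegral => w _; rewrite (hE (fun i u => u (X i w))).
  - exact: leqnSn.
  - by move=> i; rewrite /h; case: ifP.
  - by move=> i x; rewrite /h; case: ifP => // _; rewrite normr1.
  - by move=> i im; rewrite /h ltn_eqF.
have L t (f : V -> R) : measurable_fun setT f -> (forall x, `|f x| <= 1) ->
    L1 P (fun w => cos (t + r * \sum_(i < n) g (X i w)) * f (X n w)).
  move=> mf f1; apply: (@L1_bounded _ _ _ _ _ 1) => [|w].
    by apply: measurable_funM => //; exact: measurableT_comp.
  by rewrite normrM mulr_ile1 ?cos_max.
rewrite -(c _ (fun x => cos (r * g x)))// => [|x]; last exact: cos_max.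
rewrite -(c _ (fun x => sin (r * g x)))// => [|x]; last exact: sin_max.
rewrite -IntB; last 2 first.
- by apply: (L _ (fun x => cos (r * g x))) => // x; exact: cos_max.
- by apply: (L _ (fun x => sin (r * g x))) => // x; exact: sin_max.
apply: eq_Rintegral => w _; rewrite big_ord_recr/= mulrDr addrA cosD.
by congr (_ - _ * _); rewrite addrAC cosBpihalf.
Qed.

Let g_L1 j : L1 F (fun x => g x ^+ j).
Proof.
apply: (@L1_bounded _ _ _ _ _ (B ^+ j)) => [|x]; first exact: measurable_funX.
by rewrite normrX lerXn2r// nnegrE.
Qed.

Let gX_le j x : `|g x| ^+ j <= B ^+ j.
Proof. by rewrite lerXn2r// nnegrE. Qed.

Let s2_ge0 : 0 <= s2. Proof. by apply: Rintegral_ge0 => x _; exact: sqr_ge0. Qed.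

Let s2_le : s2 <= B ^+ 2.
Proof.
rewrite (le_trans (ler_norm _))//; apply: Int_le_bound => [|x].
  exact: measurable_funX.
by rewrite normrX.
Qed.

(** The mean of the cosine and the exponential are both within [B ^+ 4 * r ^+ 4] of [1 - y]. *)
Let int_cos r : 0 <= r ->
  `|\int[F]_x cos (r * g x) - expR (- (r ^+ 2 * s2 / 2))| <= 2 * B ^+ 4 * r ^+ 4.
Proof.
move=> r0; set y := r ^+ 2 * s2 / 2.
have y0 : 0 <= y by rewrite divr_ge0// mulr_ge0// exprn_ge0.
have yB : y ^+ 2 <= B ^+ 4 * r ^+ 4.
  apply: (@le_trans _ _ ((B ^+ 2 * r ^+ 2) ^+ 2)); last first.
    by rewrite exprMn -!exprM.
  rewrite lerXn2r ?nnegrE ?mulr_ge0 ?exprn_ge0// /y.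
  have := ler_wpM2l (exprn_ge0 2 r0) s2_le; have := mulr_ge0 (exprn_ge0 2 r0) s2_ge0.
  lra.
have h1 : `|\int[F]_x cos (r * g x) - (1 - y)| <= B ^+ 4 * r ^+ 4.
  have -> : 1 - y = \int[F]_x (1 - r ^+ 2 / 2 * g x ^+ 2).
    by rewrite IntB ?Int_cst ?IntZ// /y /s2; [lra|exact: L1_cst|exact: L1Z].
  have cL : L1 F (fun x => cos (r * g x)).
    by apply: (@L1_bounded _ _ _ _ _ 1) => // x; exact: cos_max.
  have qL : L1 F (fun x => 1 - r ^+ 2 / 2 * g x ^+ 2).
    by apply: L1B; [exact: L1_cst|exact: L1Z].
  rewrite -IntB//; apply: Int_le_bound => [|x]; first exact: L1_measurable (L1B cL qL).
  have := cos_taylor2 (r * g x).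
  rewrite (_ : _ - _ + _ = cos (r * g x) - (1 - r ^+ 2 / 2 * g x ^+ 2)); last by field.
  move/le_trans; apply; rewrite exprMn mulrC ler_wpM2r ?exprn_ge0//.
  by rewrite (le_trans _ (gX_le 4 x))// -normrX ler_norm.
have h2 := le_trans (expRN_taylor y0) yB.
rewrite (_ : _ - _ = (\int[F]_x cos (r * g x) - (1 - y)) - (expR (- y) - 1 + y)); last by ring.
by rewrite (le_trans (ler_normB _ _))// (le_trans (lerD h1 h2))//; lra.
Qed.

Let int_sin r : 0 <= r -> `|\int[F]_x sin (r * g x)| <= B ^+ 3 * r ^+ 3.
Proof.
move=> r0.
have sL : L1 F (fun x => sin (r * g x)).
  by apply: (@L1_bounded _ _ _ _ _ 1) => // x; exact: sin_max.
have gL : L1 F (fun x => r * g x) by exact/L1Z/(g_L1 1).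
rewrite -[X in `|X|]subr0 -(mulr0 r) -g0 -IntZ; last exact: (g_L1 1).
rewrite -IntB//; apply: Int_le_bound => [|x]; first exact: L1_measurable (L1B sL gL).
rewrite (le_trans (sin_taylor _))// normrM exprMn (ger0_norm r0) mulrC.
by rewrite ler_wpM2r ?exprn_ge0.
Qed.

Let cosC_le1 r th n : `|cosC r th n| <= 1.
Proof. by apply: Int_le_bound => // w; exact: cos_max. Qed.

(** The old error is multiplied by [E <= 1] and the new one is at most [K * r ^+ 3] for every phase,
    so errors grow linearly in [n]. *)
Let cosC_bound r n th : 0 <= r <= 1 ->
  `|cosC r th n - cos th * expR (- (r ^+ 2 * s2 / 2)) ^+ n| <= n%:R * (K * r ^+ 3).
Proof.
move=> /andP[r0 r1]; elim: n => [|n IH].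
  rewrite expr0 mulr1 mul0r /cosC.
  under eq_Rintegral do rewrite big_ord0 mulr0 addr0.
  by rewrite Int_cst subrr normr0.
set E := expR _ in IH *; rewrite cosC_step.
set a := \int[F]_x cos _; set b := \int[F]_x sin _.
have -> : cosC r th n * a - cosC r (th - pi / 2) n * b - cos th * E ^+ n.+1 =
  E * (cosC r th n - cos th * E ^+ n) + (cosC r th n * (a - E) - cosC r (th - pi / 2) n * b).
  by rewrite exprS; ring.
rewrite -[n.+1%:R]natr1 [leRHS]mulrDl mul1r (le_trans (ler_normD _ _))// lerD//.
  rewrite normrM (le_trans _ IH)// ler_piMl// ger0_norm ?expR_ge0//.
  by rewrite /E -expR0 ler_expR oppr_le0 divr_ge0// mulr_ge0 ?exprn_ge0.
rewrite (le_trans (ler_normB _ _))// !normrM.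
have h1 : `|cosC r th n| * `|a - E| <= 2 * B ^+ 4 * r ^+ 3.
  rewrite (le_trans (_ : _ <= `|a - E|))//; first by rewrite ler_piMl.
  rewrite (le_trans (int_cos r0))// ler_wpM2l// ?mulr_ge0 ?exprn_ge0//.
  by rewrite exprS ler_piMl ?exprn_ge0.
have h2 : `|cosC r (th - pi / 2) n| * `|b| <= B ^+ 3 * r ^+ 3.
  rewrite (le_trans (_ : _ <= `|b|))//; first by rewrite ler_piMl.
  exact: int_sin.
by rewrite [leRHS]mulrDl; exact: lerD.
Qed.

Lemma clt_cos th :
  \int[P]_w cos (th + (Num.sqrt n%:R)^-1 * \sum_(i < n) g (X i w)) @[n --> \oo] -->
  cos th * expR (- (s2 / 2)).
Proof.
have K0 : 0 <= K by rewrite addr_ge0 ?mulr_ge0 ?exprn_ge0.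
apply/cvgrPdist_le => e e0; near=> n.
have n0 : (0 < n)%N by near: n; exact: nbhs_infty_gt.
have n0' : 0 < n%:R :> R by rewrite ltr0n.
set r := (Num.sqrt n%:R)^-1.
have s0 : 0 < Num.sqrt (n%:R : R) by rewrite sqrtr_gt0.
have r2 : r ^+ 2 = n%:R^-1 by rewrite exprVn sqr_sqrtr// ltW.
have r01 : 0 <= r <= 1.
  by rewrite invr_ge0 ltW//= invf_le1// -[leLHS]sqrtr1 ler_sqrt// ler1n.
(* As [r ^+ 2 = 1 / n], the [n]-th power is exactly [expR (- (s2 / 2))] and the error
   [n * K * r ^+ 3] is [K * r]. *)
have := @cosC_bound r n th r01; rewrite -expRM_natl r2.
rewrite (_ : n%:R * - _ = - (s2 / 2)); last by field; rewrite gt_eqF.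
rewrite (_ : n%:R * _ = K * r); last first.
  by rewrite exprS r2; field; rewrite gt_eqF.
rewrite distrC => /le_trans; apply.
rewrite ler_pdivrMr// -ler_pdivrMl//.
rewrite -[leLHS]ger0_norm ?mulr_ge0 ?invr_ge0 ?(ltW e0)// -sqrtr_sqr ler_sqrt//.
by near: n; exact: nbhs_infty_ger.
Unshelve. all: by end_near. Qed.

End clt.
End iid.

(** * Law of large numbers *)

Section law_of_large_numbers.
Variables (R : realType) (k : nat) (d : measure_display) (T : measurableType d).
Variables (P : probability T R) (F : probability (vecR R k) R).
Variable X : nat -> T -> vecR R k.
Hypothesis iidX : iid_with P X F.
Local Notation V := (vecR R k).

Let mX i : measurable_fun setT (X i). Proof. by case: iidX. Qed.

Lemma ge0_iid_law i (f : V -> \bar R) : measurable_fun setT f ->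
  (forall x, 0 <= f x)%E -> (\int[P]_w f (X i w) = \int[F]_x f x)%E.
Proof.
move=> mf f0; case: iidX => _ lawX _.
pose Y : {mfun T >-> V} :=
  MeasurableFun.Pack (MeasurableFun.Class (isMeasurableFun.Build _ _ _ _ _ (mX i))).
rewrite -(@ge0_integral_distribution _ _ _ _ _ P Y f mf f0).
by apply: eq_measure_integral => A mA _; exact: lawX.
Qed.

Lemma iid_L1 i (g : V -> R) : L1 F g -> L1 P (fun w => g (X i w)).
Proof.
move=> gi; have mg := L1_measurable gi; apply/integrableP; split.
  by apply/measurable_EFinP; exact: measurableT_comp.
rewrite (ge0_iid_law i (f := fun x => `|(g x)%:E|%E)) => [|//|//].
- by case/integrableP : gi.
- by apply/measurableT_comp => //; exact/measurable_EFinP.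
Qed.

Lemma iid_law_ge0 i (g : V -> R) : L1 F g -> (forall x, 0 <= g x) ->
  \int[P]_w g (X i w) = \int[F]_x g x.
Proof.
move=> gi g0; rewrite /Rintegral (ge0_iid_law i (f := EFin \o g))//.
exact/measurable_EFinP/L1_measurable/gi.
Qed.

Lemma truncation_L1 (g : V -> R) (e : R) : L1 F g -> 0 < e ->
  exists2 M, 0 < M &
    \int[F]_x `|g x - (if `|g x| <= M then g x else 0)| <= e.
Proof.
move=> gi e0; have mg := L1_measurable gi.
pose h (n : nat) x := g x - (if `|g x| <= n.+1%:R then g x else 0).
have mh n : measurable_fun setT (h n).
  apply: measurable_funB => //; apply: measurable_fun_if => //.
  - by apply: measurable_fun_ler => //; exact: measurableT_comp.
  - exact: measurable_funTS.
have hg n x : `|h n x| <= `|g x|.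
  by rewrite /h; case: ifP => _; rewrite ?subrr ?normr0// subr0.
have hL n : L1 F (fun x => `|h n x|).
  by apply/L1_norm/(L1_le (mh n) (L1_norm gi)).
have [] := @dominated_convergence _ _ R F setT measurableT
  (fun n x => `|h n x|%:E) (cst 0%E) (fun x => `|g x|%:E) _ (measurable_cst _)
  _ (L1_norm gi) _.
- by move=> n; case/integrableP : (hL n).
- apply: aeW => x _; apply: cvg_near_cst; near=> n.
  rewrite /h ifT ?subrr ?normr0//.
  by rewrite (@le_trans _ _ n%:R) ?ler_nat//; near: n; exact: nbhs_infty_ger.
- by apply: aeW => x n _; rewrite /= lee_fin normr_id.
move=> _ _; rewrite integral0 => /fine_cvgP[_ /cvgr0_norm_le/(_ _ e0)].
move=> [N _ /(_ N (leqnn N))] /= hN; exists N.+1%:R; first by rewrite ltr0n.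
exact: le_trans (ler_norm _) hN.
Unshelve. all: by end_near. Qed.

(** [g] is truncated at level [M]: the centred truncation [h] is handled by its variance, the
    cut-off part [r] by its small mean, and the mean [m] of the truncation is small because [g] has
    mean zero. *)
Lemma wlln_L1 (g : V -> R) : L1 F g -> \int[F]_x g x = 0 ->
  \int[P]_w `|n%:R^-1 * \sum_(i < n) g (X i w)| @[n --> \oo] --> 0.
Proof.
move=> gi g0; have mg := L1_measurable gi.
apply/cvgrPdist_le => e e0.
have [M M0 gM] := truncation_L1 gi (divr_gt0 e0 (ltr0n _ 4)).
pose t x := if `|g x| <= M then g x else 0.
have mt : measurable_fun setT t.
  apply: measurable_fun_if => //.
  - by apply: measurable_fun_ler => //; exact: measurableT_comp.
  - exact: measurable_funTS.
have tM x : `|t x| <= M by rewrite /t; case: ifP => // _; rewrite normr0 ltW.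
have tL : L1 F t by exact: L1_bounded tM.
pose r x := `|g x - t x|.
have rL : L1 F r by apply: L1_norm; exact: L1B.
pose m := \int[F]_x t x.
have mle : `|m| <= e / 4.
  rewrite -normrN -[- m]add0r -g0 -IntB// (le_trans (Int_norm _)) ?gM//.
  exact: L1B.
pose h x := t x - m.
have mM : `|m| <= M by apply: Int_le_bound.
have mh : measurable_fun setT h by exact: measurable_funB.
have hM x : `|h x| <= 2 * M.
  by rewrite (le_trans (ler_normB _ _))// mulr2n mulrDl mul1r lerD.
have h0 : \int[F]_x h x = 0.
  by rewrite IntB ?Int_cst ?subrr//; exact: L1_cst.
near=> n.
have n0 : (0 < n)%N by near: n; exact: nbhs_infty_gt.
have n0' : 0 < n%:R :> R by rewrite ltr0n.
pose S w := n%:R^-1 * \sum_(i < n) h (X i w).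
have mS : measurable_fun setT S.
  by apply: measurable_funM => //; apply: measurable_sum => i; exact: measurableT_comp.
have gL : L1 P (fun w => `|n%:R^-1 * \sum_(i < n) g (X i w)|).
  by apply/L1_norm/L1Z/L1_sum => i; exact: iid_L1.
have S_le w : `|S w| <= 2 * M.
  rewrite normrM gtr0_norm ?invr_gt0// ler_pdivrMl//.
  rewrite (le_trans (ler_norm_sum _ _ _))//.
  apply: (@le_trans _ _ (\sum_(i < n) 2 * M)); first by apply: ler_sum => i _; exact: hM.
  by rewrite sumr_const card_ord -[leLHS]mulr_natl.
have S2L : L1 P (fun w => S w ^+ 2).
  apply: (@L1_bounded _ _ _ _ _ ((2 * M) ^+ 2)); first exact: measurable_funX.
  by move=> w; rewrite normrX lerXn2r// nnegrE mulr_ge0// ltW.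
have S2 : \int[P]_w (S w ^+ 2) <= n%:R^-1 * (4 * M ^+ 2).
  under eq_Rintegral do rewrite exprMn.
  have sL : L1 P (fun w => (\sum_(i < n) h (X i w)) ^+ 2).
    rewrite (_ : _ \o _ = EFin \o (fun w => n%:R ^+ 2 * (S w ^+ 2))); first exact: L1Z.
    apply/funext => w /=; rewrite /S exprMn mulrA -exprMn divff ?expr1n ?mul1r//.
    by rewrite gt_eqF.
  rewrite IntZ// (iid_sum_sqr iidX n mh hM h0).
  rewrite (_ : _ * _ = n%:R^-1 * \int[F]_x (h x ^+ 2)); last by field; rewrite gt_eqF.
  rewrite ler_wpM2l ?invr_ge0//; apply: le_trans (ler_norm _) _.
  apply: Int_le_bound; first exact: measurable_funX.
  move=> x; rewrite normrX (_ : 4 * M ^+ 2 = (2 * M) ^+ 2); last by ring.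
  by rewrite lerXn2r// nnegrE mulr_ge0// ltW.
have bL : L1 P (fun w => e / 4 + e^-1 * S w ^+ 2 + e / 4 + n%:R^-1 * \sum_(i < n) r (X i w)).
  apply: L1D; last by apply/L1Z/L1_sum => i; exact: iid_L1.
  by apply: L1D; [apply: L1D; [exact: L1_cst|exact: L1Z]|exact: L1_cst].
rewrite sub0r normrN ger0_norm; last by apply: Rintegral_ge0.
apply: (@le_trans _ _ (\int[P]_w
  (e / 4 + e^-1 * S w ^+ 2 + e / 4 + n%:R^-1 * \sum_(i < n) r (X i w)))).
  apply: Int_le => // w.
  have -> : n%:R^-1 * \sum_(i < n) g (X i w) =
      S w + m + n%:R^-1 * \sum_(i < n) (g (X i w) - t (X i w)).
    rewrite /S /h !sumrB sumr_const card_ord -[_ *+ n]mulr_natl.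
    by field; rewrite gt_eqF.
  rewrite (le_trans (ler_normD _ _))// lerD//; last first.
    by rewrite normrM gtr0_norm ?invr_gt0// ler_wpM2l ?invr_ge0// ler_norm_sum.
  rewrite (le_trans (ler_normD _ _))// lerD//.
  (* The square gives [|S| <= e / 4 + S ^+ 2 / e], which passes from the second moment to the first.
     Together with [m] and [r] this makes four contributions of [e / 4]. *)
  have := sqr_ge0 (`|S w| - e / 2); rewrite sqrrB real_normK ?num_real// => hh.
  rewrite -(ler_pM2l e0) mulrDr mulVKf ?gt_eqF//.
  by move: hh; rewrite -mulr_natl expr2; nra.
rewrite IntD; last 2 first.
- by apply: L1D; [apply: L1D; [exact: L1_cst|exact: L1Z]|exact: L1_cst].
- by apply/L1Z/L1_sum => i; exact: iid_L1.
rewrite IntD; [|by apply: L1D; [exact: L1_cst|exact: L1Z]|exact: L1_cst].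
rewrite IntD; [|exact: L1_cst|exact: L1Z].
rewrite !Int_cst IntZ// IntZ; last by apply: L1_sum => i; exact: iid_L1.
rewrite Int_sum => [|i]; last exact: iid_L1.
rewrite (eq_bigr (fun=> \int[F]_x r x)) => [|i _]; last first.
  by apply: iid_law_ge0 => // x; exact: normr_ge0.
rewrite (_ : n%:R^-1 * _ = \int[F]_x r x); last first.
  by rewrite sumr_const card_ord -[X in _ * X]mulr_natl mulKf// gt_eqF.
have en : e^-1 * (n%:R^-1 * (4 * M ^+ 2)) <= e / 4.
  rewrite mulrCA ler_pdivrMl// -ler_pdivrMr ?divr_gt0//.
  by near: n; exact: nbhs_infty_ger.
have := ler_wpM2l (ltW (_ : 0 < e^-1)) S2; rewrite invr_gt0 => /(_ e0) h2.
rewrite [leRHS](_ : e = e / 4 + e / 4 + e / 4 + e / 4); last by field.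
by rewrite lerD// lerD// lerD// (le_trans h2).
Unshelve. all: by end_near. Qed.

End law_of_large_numbers.

(** * Expansion of the spatial sign *)

Section euclidean_norm.
Variables (R : realType) (k : nat).
Implicit Types y v : 'rV[R]_k.

Lemma enorm_ge0 y : 0 <= enorm y. Proof. exact: sqrtr_ge0. Qed.

Lemma enorm_sqr y : enorm y ^+ 2 = dotp y y.
Proof.
rewrite sqr_sqrtr; last by apply: sumr_ge0 => i _; exact: sqr_ge0.
by apply: eq_bigr => i _; rewrite expr2.
Qed.

Lemma coord_le_enorm y i : `|y ord0 i| <= enorm y.
Proof.
rewrite -sqrtr_sqr ler_sqrt; last by apply: sumr_ge0 => j _; exact: sqr_ge0.
by rewrite (bigD1 i)//= lerDl sumr_ge0// => j _; exact: sqr_ge0.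
Qed.

Lemma enorm_eq0 y : (enorm y == 0) = (y == 0).
Proof.
apply/eqP/eqP => [y0|->].
  apply/rowP => i; rewrite mxE; apply/eqP; rewrite -normr_le0 -y0.
  exact: coord_le_enorm.
by rewrite /enorm big1 ?sqrtr0// => i _; rewrite mxE expr0n.
Qed.

Lemma enormN y : enorm (- y) = enorm y.
Proof. by congr Num.sqrt; apply: eq_bigr => i _; rewrite mxE sqrrN. Qed.

Lemma enormB_sqr y v : enorm (y - v) ^+ 2 = enorm y ^+ 2 - 2 * dotp y v + enorm v ^+ 2.
Proof.
rewrite !enorm_sqr /dotp mulr_sumr -sumrB -big_split/=; apply: eq_bigr => i _.
by rewrite !mxE; ring.
Qed.

(** Cauchy-Schwarz, from the squared norm of [enorm v *: y - enorm y *: v]. *)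
Lemma dotp_le y v : dotp y v <= enorm y * enorm v.
Proof.
have [y0|y0] := eqVneq y 0; first by rewrite y0 dotp0l mulr_ge0// enorm_ge0.
have [v0|v0] := eqVneq v 0; first by rewrite v0 dotp0r mulr_ge0// enorm_ge0.
have A0 : 0 < enorm y by rewrite lt_def enorm_eq0 y0 enorm_ge0.
have V0 : 0 < enorm v by rewrite lt_def enorm_eq0 v0 enorm_ge0.
have := exprn_ge0 2 (enorm_ge0 (enorm v *: y - enorm y *: v)).
rewrite enormB_sqr dotpZr.
have eZ a u : enorm (a *: u : 'rV[R]_k) ^+ 2 = a ^+ 2 * enorm u ^+ 2.
  by rewrite !enorm_sqr /dotp mulr_sumr; apply: eq_bigr => i _; rewrite !mxE; ring.
have -> : dotp (enorm v *: y) v = enorm v * dotp y v.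
  by rewrite /dotp mulr_sumr; apply: eq_bigr => i _; rewrite !mxE mulrA.
rewrite !eZ => h; rewrite -(ler_pM2l (mulr_gt0 A0 V0)); lra.
Qed.

Lemma dotp_norm_le y v : `|dotp y v| <= enorm y * enorm v.
Proof. by rewrite ler_norml dotp_le andbT lerNl -dotpNl -(enormN y) dotp_le. Qed.

Lemma enormB_ge y v : enorm y - enorm v <= enorm (y - v).
Proof.
have [h|h] := leP (enorm y - enorm v) 0; first exact: le_trans (enorm_ge0 _).
rewrite -(ler_pXn2r (n := 2))// ?nnegrE ?enorm_ge0 ?(ltW h)//.
by rewrite enormB_sqr sqrrB; have := dotp_le y v; lra.
Qed.

End euclidean_norm.

Section spatial_sign_expansion.
Variables (R : realType) (k : nat).
Implicit Types y v : 'rV[R]_k.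

Lemma souterE y i j : souter y i j = y ord0 i * y ord0 j / enorm y ^+ 2.
Proof.
by rewrite /souter /ssign mxE big_ord1 !mxE expr2 invfM; ring.
Qed.

Lemma souter_le1 y i j : `|souter y i j| <= 1.
Proof.
rewrite souterE; have [->|y0] := eqVneq (enorm y) 0.
  by rewrite expr0n/= invr0 mulr0 normr0.
have A0 : 0 < enorm y by rewrite lt_def y0 enorm_ge0.
rewrite normrM [X in _ * X]ger0_norm ?invr_ge0 ?exprn_ge0 ?enorm_ge0//.
rewrite ler_pdivrMr ?exprn_gt0// mul1r normrM expr2.
by rewrite ler_pM// coord_le_enorm.
Qed.

(* Minus the derivative of y |-> souter y i j along the m-th coordinate, for
   y != 0. *)
Definition sgrad i j y m : R :=
  2 * (y ord0 i * y ord0 j * y ord0 m / enorm y ^+ 4) -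
  ((i == m)%:R * (y ord0 j / enorm y ^+ 2) + (j == m)%:R * (y ord0 i / enorm y ^+ 2)).

Lemma sgrad_sum i j y v : \sum_m v ord0 m * sgrad i j y m =
  2 * (y ord0 i * y ord0 j * dotp y v / enorm y ^+ 4) -
  (v ord0 i * y ord0 j + v ord0 j * y ord0 i) / enorm y ^+ 2.
Proof.
have pick l c : \sum_m v ord0 m * ((l == m)%:R * c) = v ord0 l * c.
  rewrite (bigD1 l)//= eqxx mul1r big1 ?addr0// => m ml.
  by rewrite eq_sym (negbTE ml) mul0r mulr0.
rewrite (eq_bigr (fun m => 2 * (y ord0 i * y ord0 j / enorm y ^+ 4) * (y ord0 m * v ord0 m) -
  (v ord0 m * ((i == m)%:R * (y ord0 j / enorm y ^+ 2)) +
   v ord0 m * ((j == m)%:R * (y ord0 i / enorm y ^+ 2))))); last first.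
  by move=> m _; rewrite /sgrad; ring.
by rewrite sumrB -mulr_sumr -/(dotp y v) big_split/= !pick; ring.
Qed.

(** All is scaled by [|y|]: [a], [b] are coordinates of [y / |y|], [al], [be] those of [v / |y|],
    [s = <y, v> / |y|^2], [x = |v| / |y|] and [q = |y - v|^2 / |y|^2]. *)
Lemma scalar_expansion (a b al be s x q : R) :
  `|a| <= 1 -> `|b| <= 1 -> `|al| <= x -> `|be| <= x -> `|s| <= x -> x <= 1 / 2 ->
  q = 1 - 2 * s + x ^+ 2 -> 1 / 4 <= q ->
  `|(a - al) * (b - be) / q - a * b - (2 * (a * b * s) - (al * b + be * a))|
    <= 48 * x ^+ 2.
Proof.
move=> ha hb hal hbe hs hx qE hq.
have x0 : 0 <= x by apply: le_trans hs.
have q0 : 0 < q by lra.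
(* [z = 1 - q]; over the denominator [q], the terms of order zero and one in [x] cancel. *)
pose z := 2 * s - x ^+ 2.
have zx : `|z| <= 5 / 2 * x.
  rewrite (le_trans (ler_normB _ _))// normrM ger0_norm// (ger0_norm (sqr_ge0 x)).
  by nra.
have -> : (a - al) * (b - be) / q - a * b - (2 * (a * b * s) - (al * b + be * a)) =
    (al * be - x ^+ 2 * (a * b) - z * (al * b + be * a) + 2 * (z * (a * b) * s)) / q.
  have q0' : q != 0 by rewrite gt_eqF.
  apply: (mulIf q0'); rewrite divfK// mulrBl mulrBl divfK// /z qE; ring.
have ab : `|a * b| <= 1 by rewrite normrM mulr_ile1.
have n1 : `|al * be| <= x ^+ 2 by rewrite normrM expr2 ler_pM.
have n2 : `|x ^+ 2 * (a * b)| <= x ^+ 2.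
  by rewrite normrM ger0_norm ?sqr_ge0// ler_piMr// sqr_ge0.
have n3 : `|al * b + be * a| <= 2 * x.
  rewrite (le_trans (ler_normD _ _))// mulr2n mulrDl mul1r !normrM lerD//.
    by rewrite -[leRHS]mulr1 ler_pM.
  by rewrite -[leRHS]mulr1 ler_pM.
have n4 : `|z * (al * b + be * a)| <= 5 * x ^+ 2.
  rewrite normrM (le_trans (ler_pM _ _ zx n3))//; lra.
have n5 : `|z * (a * b) * s| <= 5 / 2 * x ^+ 2.
  rewrite normrM (_ : 5 / 2 * x ^+ 2 = 5 / 2 * x * x); last by ring.
  rewrite ler_pM// normrM (le_trans _ zx)// ler_piMr//.
rewrite normrM [X in _ * X]gtr0_norm ?invr_gt0// ler_pdivrMr//.
have n6 : `|2 * (z * (a * b) * s)| = 2 * `|z * (a * b) * s|.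
  by rewrite normrM ger0_norm.
(* 12 is 1 + 1 + 5 + 5, and division by [q >= 1 / 4] turns it into 48. *)
have num : `|al * be - x ^+ 2 * (a * b) - z * (al * b + be * a) + 2 * (z * (a * b) * s)|
    <= 12 * x ^+ 2.
  rewrite (le_trans (ler_normD _ _))// (le_trans (lerD (ler_normB _ _) (lexx _)))//.
  rewrite (le_trans (lerD (lerD (ler_normB _ _) (lexx _)) (lexx _)))//.
  by rewrite n6; lra.
by rewrite (le_trans num)//; have := sqr_ge0 x; nra.
Qed.

Lemma souter_expansion y v i j : enorm y != 0 ->
  `|souter (y - v) i j - souter y i j - \sum_m v ord0 m * sgrad i j y m| <=
  48 * ((enorm v * Num.sqrt (enorm v)) * ((enorm y)^-1 * Num.sqrt (enorm y)^-1)).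
Proof.
move=> y0; set A := enorm y in y0 *; set V := enorm v.
have A0 : 0 < A by rewrite lt_def y0 enorm_ge0.
have V0 : 0 <= V by exact: enorm_ge0.
pose x := V / A.
have x0 : 0 <= x by rewrite divr_ge0// ltW.
have -> : V * Num.sqrt V * (A^-1 * Num.sqrt A^-1) = x * Num.sqrt x.
  by rewrite /x sqrtrM// mulrACA.
have cy l : `|y ord0 l / A| <= 1.
  by rewrite normrM [X in _ * X]gtr0_norm ?invr_gt0// ler_pdivrMr// mul1r coord_le_enorm.
have cv l : `|v ord0 l / A| <= x.
  rewrite normrM [X in _ * X]gtr0_norm ?invr_gt0// ler_wpM2r ?invr_ge0 ?(ltW A0)//.
  exact: coord_le_enorm.
have cs : `|dotp y v / A ^+ 2| <= x.
  rewrite normrM [X in _ * X]gtr0_norm ?invr_gt0 ?exprn_gt0// ler_pdivrMr ?exprn_gt0//.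
  by rewrite (le_trans (dotp_norm_le _ _))// -/A -/V /x expr2 mulrA divfK// mulrC.
have gE : \sum_m v ord0 m * sgrad i j y m =
    2 * ((y ord0 i / A) * (y ord0 j / A) * (dotp y v / A ^+ 2)) -
    (v ord0 i / A * (y ord0 j / A) + v ord0 j / A * (y ord0 i / A)).
  by rewrite sgrad_sum -/A; field.
have [hx|hx] := leP x (1 / 2).
  have Q : A / 2 <= enorm (y - v).
    apply: le_trans (enormB_ge y v); rewrite -/A -/V.
    by move: hx; rewrite /x ler_pdivrMr//; lra.
  have Q0 : 0 < enorm (y - v) by apply: lt_le_trans Q; rewrite divr_gt0.
  pose q := enorm (y - v) ^+ 2 / A ^+ 2.
  have qE : q = 1 - 2 * (dotp y v / A ^+ 2) + x ^+ 2.
    by rewrite /q enormB_sqr -/A -/V /x; field.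
  have q4 : 1 / 4 <= q.
    rewrite /q ler_pdivlMr ?exprn_gt0//.
    rewrite (_ : 1 / 4 * A ^+ 2 = (A / 2) ^+ 2); last by field.
    by rewrite lerXn2r// nnegrE ltW// divr_gt0.
  have := scalar_expansion (cy i) (cy j) (cv i) (cv j) cs hx qE q4.
  rewrite -gE => h.
  have -> : souter (y - v) i j - souter y i j =
      (y ord0 i / A - v ord0 i / A) * (y ord0 j / A - v ord0 j / A) / q
      - y ord0 i / A * (y ord0 j / A).
    rewrite !souterE !mxE -/A /q; have Qn : enorm (y - v) != 0 by rewrite gt_eqF.
    by field; rewrite y0 Qn.
  rewrite (le_trans h)// ler_wpM2l// expr2 ler_wpM2l//.
  have x1 : x <= 1 by lra.
  rewrite -{1}(sqr_sqrtr x0) expr2 ler_piMl ?sqrtr_ge0//.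
  by rewrite -sqrtr1 ler_sqrt.
(* [y - v] may vanish here; its entries are then 0 by convention and the bound by 1 persists. *)
have h1 : `|souter (y - v) i j - souter y i j| <= 2.
  rewrite (le_trans (ler_normB _ _))// (_ : 2 = 1 + 1 :> R)//.
  by rewrite lerD// souter_le1.
have h2 : `|\sum_m v ord0 m * sgrad i j y m| <= 4 * x.
  rewrite gE (le_trans (ler_normB _ _))// normrM ger0_norm//.
  have e1 : `|y ord0 i / A * (y ord0 j / A) * (dotp y v / A ^+ 2)| <= x.
    by rewrite normrM -[leRHS]mul1r ler_pM// normrM mulr_ile1.
  have e2 : `|v ord0 i / A * (y ord0 j / A)| <= x.
    by rewrite normrM -[leRHS]mulr1 ler_pM.
  have e3 : `|v ord0 j / A * (y ord0 i / A)| <= x.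
    by rewrite normrM -[leRHS]mulr1 ler_pM.
  have := ler_normD (v ord0 i / A * (y ord0 j / A)) (v ord0 j / A * (y ord0 i / A)).
  by lra.
rewrite (le_trans (ler_normB _ _))// (le_trans (lerD h1 h2))//.
have sx : 1 / 2 <= Num.sqrt x.
  rewrite -[leLHS]ger0_norm// -sqrtr_sqr ler_sqrt//; lra.
nra.
Qed.

Lemma coord_div_le y l : `|y ord0 l / enorm y| <= 1.
Proof.
have [->|y0] := eqVneq (enorm y) 0; first by rewrite invr0 mulr0 normr0.
have A0 : 0 < enorm y by rewrite lt_def y0 enorm_ge0.
by rewrite normrM [X in _ * X]gtr0_norm ?invr_gt0// ler_pdivrMr// mul1r coord_le_enorm.
Qed.

Lemma coord_div2_le y l : `|y ord0 l / enorm y ^+ 2| <= (enorm y)^-1.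
Proof.
rewrite expr2 invfM mulrA normrM [X in _ * X]ger0_norm ?invr_ge0 ?enorm_ge0//.
by rewrite ler_piMl ?invr_ge0 ?enorm_ge0// coord_div_le.
Qed.

Lemma coord_div4_le y i j m :
  `|y ord0 i * y ord0 j * y ord0 m / enorm y ^+ 4| <= (enorm y)^-1.
Proof.
rewrite (_ : _ / _ = (y ord0 i / enorm y) * (y ord0 j / enorm y) *
  (y ord0 m / enorm y ^+ 2)); last by rewrite !exprS expr0 !invfM invr1; ring.
rewrite normrM -[leRHS]mul1r ler_pM ?coord_div2_le//.
by rewrite normrM mulr_ile1 ?coord_div_le.
Qed.

Lemma inv_enorm_measurable n :
  measurable_fun setT (fun y : vecR R k => (enorm y ^+ n)^-1).
Proof.
under eq_fun do rewrite -powR_inv1 ?exprn_ge0 ?enorm_ge0//.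
apply: (measurableT_comp (measurable_powR _)).
by apply: measurable_funX; exact: enorm_measurable.
Qed.

Lemma souter_measurable i j : measurable_fun setT (fun y : vecR R k => souter y i j).
Proof.
under eq_fun do rewrite souterE.
apply: measurable_funM; last exact: inv_enorm_measurable.
by apply: measurable_funM; exact: coord_measurable.
Qed.

End spatial_sign_expansion.

(** * Replacing the estimated location by the true one *)

Lemma cvg0_bigsum (R : realType) (I : Type) (s : seq I) (u : I -> nat -> R) :
  (forall i, u i n @[n --> \oo] --> 0) ->
  \sum_(i <- s) u i n @[n --> \oo] --> 0.
Proof.
move=> u0; elim: s => [|i s IH].
  by under eq_fun do rewrite big_nil; exact: cvg_cst.
under eq_fun do rewrite big_cons.
by have := cvgD (u0 i) IH; rewrite addr0; exact.
Qed.

Lemma cvg0Z (R : realType) (a : R) (u : nat -> R) :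
  u n @[n --> \oo] --> 0 -> a * u n @[n --> \oo] --> 0.
Proof. by move=> u0; have := cvgM (@cvg_cst _ a _ _ _) u0; rewrite mulr0; exact. Qed.

Section remainder.
Variables (R : realType) (p : nat) (d : measure_display) (T : measurableType d).
Variables (P : probability T R) (F : probability (vecR R p) R).
Variables (X : nat -> T -> vecR R p) (t : 'rV[R]_p) (tn : nat -> T -> vecR R p).
Hypothesis iidX : iid_with P X F.
Hypothesis mtn : forall n, measurable_fun setT (tn n).
Hypothesis tn_rate : exists C : R, \forall n \near \oo,
  (\int[P]_w ((enorm ((tn n w : 'rV[R]_p) - t)) ^+ 4)%:E <= (C / (n%:R ^+ 2))%:E)%E.
Hypothesis moment : (\int[F]_x (if x == t then +oo
  else ((enorm ((x : 'rV[R]_p) - t)) `^ (- (3 / 2)))%:E) < +oo)%E.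
Hypothesis center1 : forall i : 'I_p,
  (\int[F]_x (((x : 'rV[R]_p) - t) ord0 i / (enorm (x - t)) ^+ 2)%:E = 0)%E.
Hypothesis center3 : forall i j k : 'I_p,
  (\int[F]_x (((x : 'rV[R]_p) - t) ord0 i * (x - t) ord0 j * (x - t) ord0 k
    / (enorm (x - t)) ^+ 4)%:E = 0)%E.
Local Notation V := (vecR R p).

Let mX i : measurable_fun setT (X i). Proof. by case: iidX. Qed.

Let sub (x : V) : V := (x : 'rV[R]_p) - t.

Let msub : measurable_fun setT sub.
Proof. by apply: vecB_measurable; exact: measurable_id. Qed.

Let A (x : V) : R := enorm (sub x).

Let A_ge0 x : 0 <= A x. Proof. exact: enorm_ge0. Qed.

Let mA : measurable_fun setT A.
Proof. exact: measurableT_comp enorm_measurable msub. Qed.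

Let eqtA (x : V) : (x == t) = (A x == 0).
Proof. by rewrite enorm_eq0 subr_eq0. Qed.

(** [|x - t|^(-3/2)], with value 0 at [x = t], where the extended-valued [f] is [+oo]. *)
Let h x : R := (A x)^-1 * Num.sqrt (A x)^-1.

Let h_ge0 x : 0 <= h x. Proof. by rewrite mulr_ge0 ?invr_ge0 ?sqrtr_ge0. Qed.

Let mh : measurable_fun setT h.
Proof.
have mi : measurable_fun setT (fun x => (A x)^-1).
  exact: measurableT_comp (inv_enorm_measurable 1) msub.
apply: measurable_funM => //.
exact: measurableT_comp (continuous_measurable_fun (@sqrt_continuous R)) mi.
Qed.

Let f (x : V) : \bar R := (if x == t then +oo else ((A x) `^ (- (3 / 2)))%:E)%E.

Let mtest : measurable_fun setT (fun x : V => x == t).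
Proof.
rewrite (_ : (fun x : V => x == t) = fun x => A x == 0); last exact/funext/eqtA.
by apply: measurable_fun_eqr => //; exact: measurable_cst.
Qed.

Let mf : measurable_fun setT f.
Proof.
apply: measurable_fun_ifT => //.
by apply/measurable_EFinP; exact: measurableT_comp (measurable_powR _) mA.
Qed.

Let f_ge0 x : (0 <= f x)%E.
Proof. by rewrite /f; case: ifP => // _; rewrite lee_fin powR_ge0. Qed.

Let h_le_f x : ((h x)%:E <= f x)%E.
Proof.
rewrite /f; case: ifPn => [_|]; first by rewrite leey.
rewrite eqtA => Ax; have A0 : 0 < A x by rewrite lt_def Ax A_ge0.
rewrite lee_fin /h -powR12_sqrt ?invr_ge0// -[(A x)^-1]powR_inv1//.
rewrite -powRrM -powRD; last by rewrite Ax implybT.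
by rewrite le_eqVlt; apply/orP; left; apply/eqP; congr (_ `^ _); field.
Qed.

Let mt : measurable [set x : V | x == t].
Proof. by rewrite -[X in measurable X]setTI; exact: mtest. Qed.

(** Since [f] is [+oo] at [t], every multiple [(N + 1) * F {t}] is at most the finite integral of
    [f]. *)
Let Ft0 : F [set x : V | x == t] = 0%E.
Proof.
have fin := moment; rewrite -[X in (X < _)%E]/(\int[F]_x f x)%E in fin.
have I0 : (0 <= \int[F]_x f x)%E by exact: integral_ge0.
have If : (\int[F]_x f x)%E \is a fin_num by rewrite ge0_fin_numE.
have Fin : F [set x : V | x == t] \is a fin_num by exact: fin_num_measure.
apply/eqP; rewrite eq_le measure_ge0 andbT -(fineK Fin) lee_fin.
apply: (@archi_le0 _ _ (fine (\int[F]_x f x)%E)) => N.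
rewrite ler_pdivlMl ?ltr0n// -lee_fin EFinM !fineK//.
have -> : F [set x : V | x == t] = (\int[F]_x (\1_[set x : V | x == t] x)%:E)%E.
  by rewrite integral_indic// setIT.
rewrite -ge0_integralZl//; last first.
  by rewrite ?lee_fin//; apply/measurable_EFinP; exact: measurable_indic.
apply: ge0_le_integral => //.
  by apply: measurable_funeM; exact/measurable_EFinP/measurable_indic.
move=> x _; rewrite indicE; have [xt|xt] := boolP (x \in _).
  by move: xt; rewrite inE/= /f => ->; rewrite leey.
by rewrite mule0.
Qed.

Let h_L1 : L1 F h.
Proof.
apply/integrableP; split; first exact/measurable_EFinP.
apply: le_lt_trans moment; apply: ge0_le_integral => //.
- by apply: measurableT_comp => //; exact/measurable_EFinP.
- by move=> x _; rewrite /= ger0_norm// h_le_f.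
Qed.

(** A moment of order -3/2 thus yields one of order -1, the size of the gradient. *)
Let invA_le x : (A x)^-1 <= 1 + h x.
Proof.
rewrite /h; have b0 : 0 <= (A x)^-1 by rewrite invr_ge0.
have [b1|b1] := leP (A x)^-1 1; first by rewrite (le_trans b1)// lerDl h_ge0.
rewrite (@le_trans _ _ (h x))// ?lerDr// ler_peMr//.
by rewrite -sqrtr1 ler_sqrt// ltW.
Qed.

Let L1_invA (g : V -> R) : measurable_fun setT g -> (forall x, `|g x| <= (A x)^-1) ->
  L1 F g.
Proof.
move=> mg gA; apply: (L1_le mg (L1D (L1_cst F 1) h_L1)) => x.
exact: le_trans (gA x) (invA_le x).
Qed.

Variables (i j : 'I_p).

Let grad m (x : V) : R := sgrad i j (sub x) m.

(** The gradient is a linear combination of functions whose means (III) sets to zero. *)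
Let grad_parts m : [/\ L1 F (grad m) & \int[F]_x grad m x = 0].
Proof.
have mc l : measurable_fun setT (fun x => (sub x : 'rV[R]_p) ord0 l).
  exact: measurableT_comp (coord_measurable l) msub.
have mi n : measurable_fun setT (fun x => (A x ^+ n)^-1).
  exact: measurableT_comp (inv_enorm_measurable n) msub.
have c1 l : L1 F (fun x => (sub x : 'rV[R]_p) ord0 l / A x ^+ 2).
  apply: L1_invA => [|x]; last exact: coord_div2_le.
  exact: measurable_funM.
have c3 : L1 F (fun x => (sub x : 'rV[R]_p) ord0 i * (sub x : 'rV[R]_p) ord0 j *
    (sub x : 'rV[R]_p) ord0 m / A x ^+ 4).
  apply: L1_invA => [|x]; last exact: coord_div4_le.
  by apply: measurable_funM => //; apply: measurable_funM => //; exact: measurable_funM.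
have e1 l : \int[F]_x ((sub x : 'rV[R]_p) ord0 l / A x ^+ 2) = 0.
  exact: (congr1 fine (center1 l)).
have e3 : \int[F]_x ((sub x : 'rV[R]_p) ord0 i * (sub x : 'rV[R]_p) ord0 j *
    (sub x : 'rV[R]_p) ord0 m / A x ^+ 4) = 0.
  exact: (congr1 fine (center3 i j m)).
have q1 := L1Z 2 c3; have q2 := L1Z (i == m)%:R (c1 j); have q3 := L1Z (j == m)%:R (c1 i).
split; first exact: (L1B q1 (L1D q2 q3)).
rewrite (IntB q1 (L1D q2 q3)) (IntD q2 q3).
by rewrite (IntZ _ c3) (IntZ _ (c1 _)) (IntZ _ (c1 _)) e3 !e1 !mulr0 addr0 subr0.
Qed.

(** Takes over at [x = t], where [souter] is not differentiable and the bound through [h] would be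
    0; its mean vanishes by [Ft0]. *)
Let J (x : V) : R := \1_[set x : V | x == t] x.

Let expansion (x : V) (v : 'rV[R]_p) :
  `|souter ((sub x : 'rV[R]_p) - v) i j - souter (sub x : 'rV[R]_p) i j
    - \sum_m v ord0 m * grad m x| <=
  48 * (enorm v * Num.sqrt (enorm v) * h x) + 2 * J x.
Proof.
have [Ax|Ax] := eqVneq (A x) 0; last first.
  rewrite /J indicE memNset ?mulr0 ?addr0; last by rewrite /= eqtA (negbTE Ax).
  exact: souter_expansion.
have x0 : sub x = 0 :> 'rV[R]_p by apply/eqP; rewrite -enorm_eq0; exact/eqP.
have JE : J x = 1 by rewrite /J indicE mem_set//= eqtA Ax.
rewrite JE mulr1 big1 => [|m _]; last first.
  by rewrite /grad x0 /sgrad !mxE !mul0r !mulr0 addr0 subrr mulr0.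
rewrite subr0 (@le_trans _ _ 2)//.
  rewrite (le_trans (ler_normB _ _))// (_ : 2 = 1 + 1 :> R)//.
  by rewrite lerD// souter_le1.
by rewrite lerDr mulr_ge0// mulr_ge0 ?h_ge0// mulr_ge0 ?enorm_ge0 ?sqrtr_ge0.
Qed.

Definition Srem n w : R := Num.sqrt n%:R *
  (Sn n (fun l => (X l w : 'rV[R]_p)) (tn n w) i j -
   Sn n (fun l => (X l w : 'rV[R]_p)) t i j).

Let SnE n (x : nat -> 'rV[R]_p) u : Sn n x u i j = n%:R^-1 * \sum_(l < n) souter (x l - u) i j.
Proof. by rewrite /Sn mxE summxE. Qed.

Lemma Srem_measurable n : measurable_fun setT (Srem n).
Proof.
rewrite /Srem; under eq_fun do rewrite !SnE.
have mB (u : T -> V) l : measurable_fun setT u ->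
    measurable_fun setT (fun w => souter ((X l w : 'rV[R]_p) - u w) i j).
  move=> mu; apply: (measurableT_comp (souter_measurable i j)).
  apply: vec_measurable => m; under eq_fun do rewrite !mxE.
  by apply: measurable_funB; exact: measurableT_comp (coord_measurable m) _.
apply: measurable_funM => //; apply: measurable_funB; apply: measurable_funM => //;
  apply: measurable_sum => l.
- exact: (mB (tn n)).
- by apply: (mB (fun=> t)); exact: measurable_cst.
Qed.

Let V4 n w := enorm ((tn n w : 'rV[R]_p) - t) ^+ 4.

Let mV4 n : measurable_fun setT (V4 n).
Proof.
apply: measurable_funX.
by apply: (measurableT_comp enorm_measurable); exact: vecB_measurable.
Qed.

(* On the event sqrt n |t_n - t| <= K the linear term is at most K times the
   empirical means of the gradient; off it, Markov's inequality is built into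
   the first summand. *)
Let Srem_bound n K w : (0 < n)%N -> 0 < K ->
  Num.min 1 `|Srem n w| <= n%:R ^+ 2 / K ^+ 4 * V4 n w +
    K * (\sum_m `|n%:R^-1 * \sum_(l < n) grad m (X l w)|) +
    48 * (K * Num.sqrt (K / Num.sqrt n%:R)) * (n%:R^-1 * \sum_(l < n) h (X l w)) +
    2 * Num.sqrt n%:R * (n%:R^-1 * \sum_(l < n) J (X l w)).
Proof.
move=> n0 K0; have n0' : 0 < n%:R :> R by rewrite ltr0n.
set s := Num.sqrt n%:R.
have s0 : 0 < s by rewrite sqrtr_gt0.
have s2 : s ^+ 2 = n%:R by rewrite sqr_sqrtr// ltW.
set v : 'rV[R]_p := (tn n w : 'rV[R]_p) - t.
set t1 := _ / _ * _; set t2 := K * _; set t3 := 48 * _ * _; set t4 := 2 * s * _.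
have avg_ge0 (g : V -> R) : (forall x, 0 <= g x) -> 0 <= n%:R^-1 * \sum_(l < n) g (X l w).
  by move=> g0; rewrite mulr_ge0 ?invr_ge0// sumr_ge0.
have J_ge0 x : 0 <= J x by rewrite /J indicE.
have t1_ge0 : 0 <= t1 by rewrite !mulr_ge0 ?invr_ge0 ?exprn_ge0 ?enorm_ge0// ltW.
have t2_ge0 : 0 <= t2 by rewrite mulr_ge0 ?(ltW K0)// sumr_ge0.
have t3_ge0 : 0 <= t3.
  by rewrite mulr_ge0 ?avg_ge0// mulr_ge0// mulr_ge0 ?sqrtr_ge0// ltW.
have t4_ge0 : 0 <= t4 by rewrite mulr_ge0 ?avg_ge0// mulr_ge0// ltW.
have [hK|hK] := ltP K (s * enorm v).
  apply: (@le_trans _ _ t1); last by rewrite -!addrA lerDl !addr_ge0.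
  apply: (@le_trans _ _ 1); first by rewrite ge_min lexx.
  rewrite /t1 mulrAC ler_pdivlMr ?exprn_gt0// mul1r.
  rewrite (_ : _ * _ = (s * enorm v) ^+ 4); last by rewrite exprMn -s2 -exprM.
  by rewrite lerXn2r ?nnegrE ?mulr_ge0 ?enorm_ge0// ltW.
apply: (@le_trans _ _ (t2 + t3 + t4)); last by rewrite -!addrA lerDr.
rewrite ge_min; apply/orP; right.
have remE : Srem n w = s * (n%:R^-1 * \sum_(l < n)
    (souter ((sub (X l w) : 'rV[R]_p) - v) i j - souter (sub (X l w) : 'rV[R]_p) i j
     - \sum_m v ord0 m * grad m (X l w))) +
    \sum_m (s * v ord0 m) * (n%:R^-1 * \sum_(l < n) grad m (X l w)).
  rewrite /Srem !SnE -/s -mulrBr -sumrB [in RHS]sumrB.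
  have -> : \sum_(l < n) \sum_m v ord0 m * grad m (X l w) =
      \sum_m v ord0 m * \sum_(l < n) grad m (X l w).
    by rewrite exchange_big/=; apply: eq_bigr => m _; rewrite mulr_sumr.
  have -> : \sum_m s * v ord0 m * (n%:R^-1 * \sum_(l < n) grad m (X l w)) =
      s * (n%:R^-1 * \sum_m v ord0 m * \sum_(l < n) grad m (X l w)).
    by rewrite !mulr_sumr; apply: eq_bigr => m _; rewrite !mulrA [_ * n%:R^-1]mulrAC.
  rewrite -mulrDr -mulrDr subrK; congr (_ * (_ * _)); apply: eq_bigr => l _.
  have -> : (sub (X l w) : 'rV[R]_p) - v = (X l w : 'rV[R]_p) - tn n w.
    by rewrite /sub /v opprB addrA subrK.
  by [].
rewrite remE (le_trans (ler_normD _ _))// -addrA [t2 + _]addrC lerD//.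
  rewrite normrM gtr0_norm// normrM gtr0_norm ?invr_gt0//.
  apply: (@le_trans _ _ (s * (n%:R^-1 * \sum_(l < n)
      (48 * (enorm v * Num.sqrt (enorm v) * h (X l w)) + 2 * J (X l w))))).
    rewrite ler_wpM2l ?(ltW s0)// ler_wpM2l ?invr_ge0//.
    by rewrite (le_trans (ler_norm_sum _ _ _))// ler_sum// => l _; exact: expansion.
  rewrite big_split/= -mulr_sumr -!mulr_sumr mulrDr mulrDr lerD//; last first.
    by rewrite /t4 le_eqVlt; apply/orP; left; apply/eqP; ring.
  have vK : enorm v <= K / s by rewrite ler_pdivlMr// mulrC.
  (* [sqrt n * |v|^(3/2)] is of order [n^(-1/4)] on this event, thanks to an exponent above 1. *)
  have sv : s * (enorm v * Num.sqrt (enorm v)) <= K * Num.sqrt (K / s).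
    by rewrite mulrA ler_pM ?mulr_ge0 ?enorm_ge0 ?sqrtr_ge0 ?(ltW s0)// ler_wsqrtr.
  rewrite /t3 (_ : s * _ = 48 * (s * (enorm v * Num.sqrt (enorm v))) *
    (n%:R^-1 * \sum_(l < n) h (X l w))); last by ring.
  by rewrite ler_wpM2r ?avg_ge0// ler_wpM2l.
rewrite /t2 mulr_sumr (le_trans (ler_norm_sum _ _ _))// ler_sum// => m _.
rewrite normrM ler_wpM2r// normrM gtr0_norm// (le_trans _ hK)//.
by rewrite ler_wpM2l ?(ltW s0)// coord_le_enorm.
Qed.

(** The conclusion expresses convergence in probability. For fixed [K], the means of the four
    summands of [Srem_bound] are at most [C / K ^+ 4] by (I), vanishing by [wlln_L1], of order
    [n^(-1/4)], and zero by [Ft0]. *)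
Lemma Srem_cvg0 : \int[P]_w Num.min 1 `|Srem n w| @[n --> \oo] --> 0.
Proof.
have [C tC] := tn_rate.
apply/cvgrPdist_le => e e0.
(* [K >= 1] gives [K ^+ 4 >= K >= 4 * |C| / e]. *)
pose K := Num.max 1 (4 * `|C| / e).
have K1 : 1 <= K by rewrite le_max lexx.
have K0 : 0 < K by exact: lt_le_trans K1.
have KC : C / K ^+ 4 <= e / 4.
  rewrite ler_pdivrMr ?exprn_gt0//.
  have k4 : K <= K ^+ 4 by rewrite -{1}[K]expr1 ler_weXn2l.
  have : 4 * `|C| / e <= K by rewrite le_max lexx orbT.
  rewrite ler_pdivrMr// => k5; have := ler_norm C.
  by have := ler_wpM2r (ltW e0) k4; lra.
have gc m : K * \int[P]_w `|n%:R^-1 * \sum_(l < n) grad m (X l w)| @[n --> \oo] --> 0.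
  have [gL gz] := grad_parts m.
  exact: cvg0Z (wlln_L1 iidX gL gz).
have gsum : \sum_m K * \int[P]_w `|n%:R^-1 * \sum_(l < n) grad m (X l w)| @[n --> \oo] --> 0.
  exact: cvg0_bigsum.
pose H := \int[F]_x h x.
have H0 : 0 <= H by apply: Rintegral_ge0.
have hc : \forall n \near \oo, 48 * (K * Num.sqrt (K / Num.sqrt n%:R)) * H <= e / 4.
  pose c := 48 * K * H; have c0 : 0 <= c by rewrite !mulr_ge0// ltW.
  pose eta := e / 4 / (c + 1).
  have c1 : 0 < c + 1 by rewrite ltr_wpDl.
  have eta0 : 0 < eta by rewrite !divr_gt0.
  near=> n.
  have n0 : (0 < n)%N by near: n; exact: nbhs_infty_gt.
  have s0 : 0 < Num.sqrt (n%:R : R) by rewrite sqrtr_gt0 ltr0n.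
  have hn : (K / eta ^+ 2) ^+ 2 <= n%:R by near: n; exact: nbhs_infty_ger.
  have hK : Num.sqrt (K / Num.sqrt n%:R) <= eta.
    rewrite -[leRHS]ger0_norm ?(ltW eta0)// -sqrtr_sqr ler_wsqrtr//.
    rewrite ler_pdivrMr// mulrC -ler_pdivrMr ?exprn_gt0//.
    rewrite -[leLHS]ger0_norm ?divr_ge0 ?exprn_ge0 ?(ltW K0) ?(ltW eta0)//.
    by rewrite -sqrtr_sqr ler_wsqrtr.
  rewrite (_ : _ * H = c * Num.sqrt (K / Num.sqrt n%:R)); last by rewrite /c; ring.
  apply: le_trans (ler_wpM2l c0 hK) _.
  rewrite /eta mulrCA ler_piMr ?divr_ge0 ?(ltW e0)//.
  by rewrite ler_pdivrMr// mul1r lerDl.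
have /cvgr0_norm_le/(_ _ (divr_gt0 e0 (ltr0n _ 4))) gs := gsum.
near=> n.
have n0 : (0 < n)%N by near: n; exact: nbhs_infty_gt.
have n0' : 0 < n%:R :> R by rewrite ltr0n.
have tCn : (\int[P]_w (V4 n w)%:E <= (C / (n%:R ^+ 2))%:E)%E by near: n.
have V4_ge0 w : 0 <= V4 n w by rewrite exprn_ge0 ?enorm_ge0.
have VL : L1 P (V4 n).
  apply/integrableP; split; first exact/measurable_EFinP.
  under eq_integral do rewrite /= ger0_norm//.
  exact: le_lt_trans tCn (ltry _).
have VE : \int[P]_w V4 n w <= C / n%:R ^+ 2 by rewrite -lee_fin Int_EFin.
have JL : L1 F J by exact: integrable_indic.
have gL m := (grad_parts m).1.
have avgL (g : V -> R) : L1 F g -> L1 P (fun w => n%:R^-1 * \sum_(l < n) g (X l w)).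
  by move=> gi; apply/L1Z/L1_sum => l; exact: (iid_L1 iidX l gi).
have avgE (g : V -> R) : L1 F g -> (forall x, 0 <= g x) ->
    \int[P]_w (n%:R^-1 * \sum_(l < n) g (X l w)) = \int[F]_x g x.
  move=> gi g0; rewrite IntZ; last by apply: L1_sum => l; exact: (iid_L1 iidX l gi).
  rewrite Int_sum => [|l]; last exact: (iid_L1 iidX l gi).
  rewrite (eq_bigr (fun=> \int[F]_x g x)) => [|l _]; last exact: (iid_law_ge0 iidX l gi g0).
  by rewrite sumr_const card_ord -[X in _ * X]mulr_natl mulKf// gt_eqF.
have l1 := L1Z (n%:R ^+ 2 / K ^+ 4) VL.
have l2 : L1 P (fun w => K * (\sum_m `|n%:R^-1 * \sum_(l < n) grad m (X l w)|)).
  by apply/L1Z/L1_sum => m; apply/L1_norm/avgL.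
have l3 := L1Z (48 * (K * Num.sqrt (K / Num.sqrt n%:R))) (avgL _ h_L1).
have l4 := L1Z (2 * Num.sqrt n%:R) (avgL _ JL).
have mm : measurable_fun setT (fun w => Num.min 1 `|Srem n w|).
  apply: measurable_minr => //.
  exact: measurableT_comp (@normr_measurable R setT) (Srem_measurable n).
rewrite sub0r normrN ger0_norm; last first.
  by apply: Rintegral_ge0 => w _; rewrite le_min ler01 normr_ge0.
apply: le_trans (Int_le _ (L1D (L1D (L1D l1 l2) l3) l4) (fun w => Srem_bound w n0 K0)) _.
  apply: (L1_bounded _ mm (M := 1)) => w.
  by rewrite ger0_norm ?ge_min ?lexx// le_min ler01 normr_ge0.
rewrite (IntD (L1D (L1D l1 l2) l3) l4) (IntD (L1D l1 l2) l3) (IntD l1 l2).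
rewrite (IntZ _ VL) (IntZ _ (avgL _ h_L1)) (IntZ _ (avgL _ JL)) !avgE//.
rewrite [X in _ + _ * X](_ : _ = 0) ?mulr0 ?addr0; last first.
  by rewrite /J Int_indic// Ft0.
rewrite IntZ; last by apply: L1_sum => m; apply/L1_norm/avgL.
rewrite Int_sum => [|m]; last by apply/L1_norm/avgL.
have b1 : n%:R ^+ 2 / K ^+ 4 * \int[P]_w V4 n w <= e / 4.
  apply: le_trans (ler_wpM2l _ VE) _; first by rewrite divr_ge0 ?exprn_ge0// ltW.
  by rewrite mulrC mulrA divfK// expf_neq0// gt_eqF.
have b2 : K * (\sum_m \int[P]_w `|n%:R^-1 * \sum_(l < n) grad m (X l w)|) <= e / 4.
  by rewrite mulr_sumr (le_trans (ler_norm _))//; near: n.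
have b3 : 48 * (K * Num.sqrt (K / Num.sqrt n%:R)) * H <= e / 4 by near: n.
by rewrite -/H; lra.
Unshelve. all: by end_near. Qed.

End remainder.

(** * Asymptotic normality *)

Section covariance.
Variables (R : realType) (p : nat) (F : probability (vecR R p) R) (t : 'rV[R]_p).
Local Notation V := (vecR R p).

(** One index pair serves all matrices, so entries of [vec] are compared without unfolding [mxvec].
    The pair is swapped by the transpose in [vec]. *)
Lemma vec_entry (a : 'I_(p * p)) :
  exists ij : 'I_p * 'I_p, forall M : 'M[R]_p, vec M ord0 a = M ij.1 ij.2.
Proof. by case/mxvec_indexP: a => i j; exists (j, i) => M; rewrite /vec mxvecE mxE. Qed.

Let Z a (x : V) : R := Zvec t x ord0 a.
Let m a := \int[F]_x Z a x.

Lemma Zvec_measurable a : measurable_fun setT (fun x : V => Zvec t x ord0 a).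
Proof.
have [ij ijE] := vec_entry a; under eq_fun do rewrite /Zvec ijE.
apply: (measurableT_comp (souter_measurable ij.1 ij.2)).
by apply: (@vecB_measurable _ _ t); exact: measurable_id.
Qed.

Lemma Zvec_le1 a x : `|Zvec t x ord0 a| <= 1.
Proof. by have [ij ijE] := vec_entry a; rewrite /Zvec ijE souter_le1. Qed.

Lemma vec_SF a : vec (SF F t) ord0 a = m a.
Proof.
have [ij ijE] := vec_entry a; rewrite ijE mxE; apply: eq_Rintegral => x _.
by rewrite /Z /Zvec ijE.
Qed.

(** The projection used in the Cramer-Wold device: the scalar central limit theorem is applied to it
    for each [u]. *)
Definition centered u (x : V) : R := dotp u (Zvec t x - vec (SF F t)).

Let centeredE u x : centered u x = \sum_a u ord0 a * (Z a x - m a).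
Proof. by apply: eq_bigr => a _; rewrite 2!mxE vec_SF. Qed.

Let ZL a : L1 F (Z a).
Proof. exact: L1_bounded (Zvec_measurable a) (Zvec_le1 a). Qed.

Let m_le1 a : `|m a| <= 1.
Proof. exact: Int_le_bound (Zvec_measurable a) (Zvec_le1 a). Qed.

Lemma centered_measurable u : measurable_fun setT (centered u).
Proof.
rewrite (_ : centered u = fun x => \sum_a u ord0 a * (Z a x - m a)); last first.
  exact/funext/centeredE.
apply: measurable_sum => a; apply: measurable_funM => //.
by apply: measurable_funB => //; exact: Zvec_measurable.
Qed.

Lemma centered_le u x : `|centered u x| <= \sum_a `|u ord0 a| * 2.
Proof.
rewrite centeredE (le_trans (ler_norm_sum _ _ _))// ler_sum// => a _.
rewrite normrM ler_wpM2l// (le_trans (ler_normB _ _))// (_ : 2 = 1 + 1 :> R)//.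
by rewrite lerD ?Zvec_le1 ?m_le1.
Qed.

Lemma centered_mean u : \int[F]_x centered u x = 0.
Proof.
under eq_Rintegral do rewrite centeredE.
have ZmL a : L1 F (fun x => Z a x - m a) by apply: L1B => //; exact: L1_cst.
rewrite Int_sum => [|a]; last exact: L1Z.
rewrite big1// => a _; rewrite IntZ// IntB//; last exact: L1_cst.
by rewrite Int_cst subrr mulr0.
Qed.

(** Besides identifying the limit variance, this makes [Wcov] positive semidefinite, as the
    construction of the limit law requires. *)
Lemma centered_var u : \int[F]_x (centered u x ^+ 2) = (u *m Wcov F t *m u^T) ord0 ord0.
Proof.
have mZ := Zvec_measurable.
have ZZL a b : L1 F (fun x => Z a x * Z b x).
  apply: (@L1_bounded _ _ _ _ _ 1) => [|x].
    by apply: measurable_funM; exact: mZ.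
  by rewrite normrM mulr_ile1// Zvec_le1.
have c1 a b : L1 F (fun x => m b * Z a x) by exact: L1Z.
have part a b : L1 F (fun x => (Z a x - m a) * (Z b x - m b)) /\
    \int[F]_x ((Z a x - m a) * (Z b x - m b)) = Wcov F t a b.
  have E x : (Z a x - m a) * (Z b x - m b) =
      Z a x * Z b x - (m b * Z a x + (m a * Z b x - m a * m b)) by ring.
  have q1 := L1B (c1 b a) (L1_cst F (m a * m b)).
  have q := L1D (c1 a b) q1.
  split; first by under eq_fun do rewrite E; exact: L1B.
  under eq_Rintegral do rewrite E.
  rewrite (IntB (ZZL a b) q) (IntD (c1 a b) q1) (IntB (c1 b a) (L1_cst F _)).
  by rewrite (Int_cst F) (IntZ _ (ZL a)) (IntZ _ (ZL b)) mxE -/(m a) -/(m b); ring.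
have sq x : centered u x ^+ 2 =
    \sum_a \sum_b (u ord0 a * u ord0 b) * ((Z a x - m a) * (Z b x - m b)).
  rewrite centeredE expr2 mulr_suml; apply: eq_bigr => a _.
  by rewrite mulr_sumr; apply: eq_bigr => b _; ring.
under eq_Rintegral do rewrite sq.
have pL a b := (part a b).1.
rewrite Int_sum => [|a]; last by apply: L1_sum => b; exact: L1Z.
rewrite mxE; under [RHS]eq_bigr do rewrite mxE mulr_suml.
rewrite exchange_big/=; apply: eq_bigr => a _.
rewrite Int_sum => [|b]; last exact: L1Z.
by apply: eq_bigr => b _; rewrite IntZ// (part a b).2 [u^T _ _]mxE; ring.
Qed.

Lemma Wcov_sym : (Wcov F t)^T = Wcov F t.
Proof.
apply/matrixP => a b; rewrite !mxE mulrC; congr (_ - _).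
by apply: eq_Rintegral => x _; rewrite mulrC.
Qed.

Lemma Wcov_psd (u : 'rV[R]_(p * p)) : 0 <= (u *m Wcov F t *m u^T) ord0 ord0.
Proof. by rewrite -centered_var; apply: Rintegral_ge0 => x _; exact: sqr_ge0. Qed.

End covariance.

Lemma cos_lipschitz (R : realType) (x y : R) : `|cos x - cos y| <= `|x - y|.
Proof.
have dc z : is_derive z (1 : R) (fun z => cos (y + z)) (- sin (y + z)).
  by apply: is_derive_eq; rewrite /GRing.scale/=; ring.
have [c _] := mvt0 (x - y) dc.
rewrite addr0 (_ : y + (x - y) = x) => [->|]; last by ring.
rewrite normrM normrN ler_piMl//.
exact: sin_max.
Qed.

(** If some [|r a| >= 1], its term alone reaches 2, the largest difference of two cosines; otherwise
    every minimum is [|r a|] and the Lipschitz bound applies. *)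
Lemma cos_perturb (R : realType) k (x y : R) (u r : 'I_k -> R) :
  x - y = \sum_a u a * r a ->
  `|cos x - cos y| <= \sum_a (2 + `|u a|) * Num.min 1 `|r a|.
Proof.
move=> xy; have min0 a : 0 <= Num.min 1 `|r a| by rewrite le_min ler01 normr_ge0.
have c2 a : 0 <= 2 + `|u a| by rewrite addr_ge0.
have [[a ra]|small] := pselect (exists a, 1 <= `|r a|).
  rewrite (bigD1 a)//= (min_idPl ra) mulr1 (@le_trans _ _ 2)//.
    by rewrite (le_trans (ler_normB _ _))// (_ : 2 = 1 + 1 :> R)// lerD ?cos_max.
  by rewrite -addrA lerDl addr_ge0// sumr_ge0// => b _; rewrite mulr_ge0.
rewrite (le_trans (cos_lipschitz _ _))// xy (le_trans (ler_norm_sum _ _ _))//.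
apply: ler_sum => a _; rewrite normrM.
have ra : `|r a| <= 1 by rewrite leNgt; apply/negP => h; apply: small; exists a; exact: ltW.
by rewrite (min_idPr ra) ler_wpM2r// lerDr.
Qed.

Lemma cvg_close (R : realType) (f g b : nat -> R) (l : R) :
  (\forall n \near \oo, `|f n - g n| <= b n) -> b n @[n --> \oo] --> 0 ->
  g n @[n --> \oo] --> l -> f n @[n --> \oo] --> l.
Proof.
move=> fg b0 gl; apply/cvgrPdist_le => e e0.
have e2 : 0 < e / 2 by rewrite divr_gt0.
have /cvgr0_norm_le/(_ _ e2) bs := b0.
have /cvgrPdist_le/(_ _ e2) gs := gl.
near=> n.
have h1 : `|f n - g n| <= b n by near: n.
have h2 : `|b n| <= e / 2 by near: n.
have h3 : `|l - g n| <= e / 2 by near: n.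
rewrite (_ : l - f n = (l - g n) - (f n - g n)); last by ring.
rewrite (le_trans (ler_normB _ _))// [leRHS]splitr lerD//.
by rewrite (le_trans h1)// (le_trans (ler_norm _)).
Unshelve. all: by end_near. Qed.

Unset Implicit Arguments.

Theorem theorem2 (R : realType) (p : nat) (d : measure_display)
  (T : measurableType d) (P : probability T R) (F : probability (vecR R p) R)
  (X : nat -> T -> vecR R p) (t : 'rV[R]_p) (tn : nat -> T -> vecR R p) :
  (2 <= p)%N ->
  iid_with P X F ->
  (forall n, measurable_fun setT (tn n)) ->
  (* (I) E|t_n - t|^4 = O(n^-2) *)
  (exists C : R, \forall n \near \oo,
     (\int[P]_w ((enorm ((tn n w : 'rV[R]_p) - t)) ^+ 4)%:E
       <= (C / (n%:R ^+ 2))%:E)%E) ->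
  (* (II) E|X - t|^(-3/2) < oo  (with 0^(-3/2) = +oo) *)
  (\int[F]_x (if x == t then +oo
              else ((enorm ((x : 'rV[R]_p) - t)) `^ (- (3 / 2)))%:E) < +oo)%E ->
  (* (III) *)
  (forall i : 'I_p,
     (\int[F]_x (((x : 'rV[R]_p) - t) ord0 i / (enorm (x - t)) ^+ 2)%:E = 0)%E) ->
  (forall i j k : 'I_p,
     (\int[F]_x (((x : 'rV[R]_p) - t) ord0 i * (x - t) ord0 j * (x - t) ord0 k
                  / (enorm (x - t)) ^+ 4)%:E = 0)%E) ->
  exists mu : probability (vecR R (p * p)) R,
    is_centered_normal mu (Wcov F t) /\
    cvg_distr P
      (fun n w => Num.sqrt (n%:R) *:
         vec (Sn n (fun i => (X i w : 'rV[R]_p)) (tn n w) - SF F t)) mu.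
Proof.
move=> _ iidX mtn tn_rate moment center1 center3.
have [mu muN] := centered_normal_exists (Wcov_sym F t) (@Wcov_psd _ _ F t).
exists mu; split=> //.
have mX l : measurable_fun setT (X l) by case: iidX.
have /choice[ij ijE] := @vec_entry R p.
pose r a := Srem X t tn (ij a).1 (ij a).2.
have r_cvg a := Srem_cvg0 iidX mtn tn_rate moment center1 center3 (ij a).1 (ij a).2.
have mr a n : measurable_fun setT (r a n) by exact: (Srem_measurable t iidX mtn).
have minL a n : L1 P (fun w => Num.min 1 `|r a n w|).
  apply: (@L1_bounded _ _ _ _ _ 1) => [|w].
    by apply: measurable_minr => //; exact: measurableT_comp (@normr_measurable R setT) (mr a n).
  by rewrite ger0_norm ?ge_min ?lexx// le_min ler01 normr_ge0.
set Y := fun n w => _.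
pose e_ a : 'rV[R]_(p * p) := delta_mx ord0 a.
pose S u n w := (Num.sqrt n%:R)^-1 * \sum_(l < n) centered F t u (X l w).
have e_dotp a v : dotp (e_ a) v = v ord0 a.
  rewrite /dotp (bigD1 a)//= big1 => [|b ba]; last by rewrite mxE (negbTE ba) andbF mul0r.
  by rewrite mxE !eqxx mul1r addr0.
(* Each entry splits into a normalised sum centred at the true [t], along the basis vector [e_ a],
   and the remainder. *)
have YE n w a : (0 < n)%N -> Y n w ord0 a = S (e_ a) n w + r a n w.
  move=> n0; have n0' : 0 < n%:R :> R by rewrite ltr0n.
  have s0 : Num.sqrt (n%:R : R) != 0 by rewrite gt_eqF// sqrtr_gt0.
  have s2 : Num.sqrt (n%:R : R) ^+ 2 = n%:R by rewrite sqr_sqrtr// ltW.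
  rewrite mxE ijE mxE [X in _ + X]mxE.
  have -> : S (e_ a) n w = Num.sqrt n%:R *
      (Sn n (fun l => (X l w : 'rV[R]_p)) t (ij a).1 (ij a).2 - SF F t (ij a).1 (ij a).2).
    rewrite /S /centered; under eq_bigr do rewrite e_dotp 2!mxE /Zvec !ijE.
    rewrite sumrB sumr_const card_ord [Sn _ _ _ _ _]mxE summxE.
    set s := Num.sqrt n%:R in s0 s2 *.
    have nE (c : R) : c *+ n = s ^+ 2 * c by rewrite s2 mulr_natl.
    by rewrite nE -s2; field.
  by rewrite /r /Srem; ring.
have YdotE u n w : (0 < n)%N ->
    dotp u (Y n w) = S u n w + \sum_a u ord0 a * r a n w.
  move=> n0; rewrite /dotp.
  under eq_bigr do rewrite YE// mulrDr.
  rewrite big_split/=; congr (_ + _).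
  rewrite /S; under eq_bigr do rewrite mulrCA.
  rewrite -mulr_sumr; congr (_ * _).
  under eq_bigr do rewrite mulr_sumr.
  rewrite exchange_big/=; apply: eq_bigr => l _.
  by rewrite /centered; apply: eq_bigr => a _; rewrite e_dotp.
have mY n : measurable_fun setT (Y n : T -> vecR R (p * p)).
  apply: vec_measurable => a; case: n => [|n].
    by under eq_fun do rewrite mxE sqrtr0 mul0r; exact: measurable_cst.
  under eq_fun do rewrite YE//.
  apply: measurable_funD => //; apply: measurable_funM => //.
  apply: measurable_sum => l.
  exact: measurableT_comp (@centered_measurable _ _ F t (e_ a)) (mX l).
have mcosS u th n : measurable_fun setT (fun w => cos (th + S u n w)).
  apply: (measurableT_comp (continuous_measurable_fun (@continuous_cos R))).
  apply: measurable_funD => //; apply: measurable_funM => //.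
  apply: measurable_sum => l.
  exact: measurableT_comp (@centered_measurable _ _ F t u) (mX l).
have mcosY u th n : measurable_fun setT (fun w => cos (th + dotp u (Y n w))).
  apply: (measurableT_comp (continuous_measurable_fun (@continuous_cos R))).
  by apply: measurable_funD => //; exact: measurableT_comp (dotp_measurable u) (mY n).
(* The limit passes from [S u] to [Y] by [cos_perturb], the means of [min 1 |r a|] tending to 0. *)
have Ycos u th : \int[P]_w cos (th + dotp u (Y n w)) @[n --> \oo] -->
    cos th * expR (- ((u *m Wcov F t *m u^T) ord0 ord0 / 2)).
  have := clt_cos iidX (@centered_measurable _ _ F t u) (@centered_le _ _ F t u)
    (@centered_mean _ _ F t u) (th := th).
  rewrite centered_var => clt; apply: (cvg_close
    (b := fun n => \sum_a (2 + `|u ord0 a|) * \int[P]_w Num.min 1 `|r a n w|) _ _ clt).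
    near=> n; have n0 : (0 < n)%N by near: n; exact: nbhs_infty_gt.
    rewrite -IntB; last 2 first.
    - by apply: (L1_bounded _ (mcosY u th n) (M := 1)) => w; exact: cos_max.
    - by apply: (L1_bounded _ (mcosS u th n) (M := 1)) => w; exact: cos_max.
    rewrite (eq_bigr (fun a => \int[P]_w ((2 + `|u ord0 a|) * Num.min 1 `|r a n w|))); last first.
      by move=> a _; rewrite IntZ.
    rewrite -Int_sum => [|a]; last exact: L1Z.
    apply: Int_norm_le => [||w].
    - apply: L1B.
        by apply: (L1_bounded _ (mcosY u th n) (M := 1)) => w; exact: cos_max.
      by apply: (L1_bounded _ (mcosS u th n) (M := 1)) => w; exact: cos_max.
    - by apply: L1_sum => a; exact: L1Z.
    - by apply: cos_perturb; rewrite YdotE// -/(S u n w); ring.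
  apply: cvg0_bigsum => a.
  exact: cvg0Z (r_cvg a).
apply: levy_continuity => // [u|u|e e0].
- have E0 : (fun n => \int[P]_w cos (0 + dotp u (Y n w))) =
      (fun n => \int[P]_w cos (dotp u (Y n w))).
    by apply/funext => n; apply: eq_Rintegral => w _; rewrite add0r.
  by have := Ycos u 0; rewrite E0 cos0 mul1r (muN u).1; exact.
- have E0 : (fun n => \int[P]_w cos (- (pi / 2) + dotp u (Y n w))) =
      (fun n => \int[P]_w sin (dotp u (Y n w))).
    by apply/funext => n; apply: eq_Rintegral => w _; rewrite addrC cosBpihalf.
  have := Ycos u (- (pi / 2)).
  by rewrite E0 cosN cos_pihalf mul0r (muN u).2; exact.
(* Tightness: [|Y_a| > 1 + L] forces [|r a| >= 1] or [|S (e_ a)| > L]. The first is controlled by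
   the mean of [min 1 |r a|], the second by Chebyshev's inequality with a variance free of [n]. *)
pose vs := \sum_a \int[F]_x (centered F t (e_ a) x ^+ 2).
have vs0 : 0 <= vs.
  by apply: sumr_ge0 => a _; apply: Rintegral_ge0 => x _; exact: sqr_ge0.
(* Being at least 1, [L] satisfies [L ^+ 2 >= L >= 2 * vs / e]. *)
pose L := 1 + 2 * vs / e.
have L1' : 1 <= L by rewrite lerDl divr_ge0 ?mulr_ge0// ltW.
have L0 : 0 < L by exact: lt_le_trans L1'.
have vL : vs / L ^+ 2 <= e / 2.
  rewrite ler_pdivrMr ?exprn_gt0//.
  have h1 : 2 * vs / e <= L by rewrite lerDr.
  have h2 : L <= L ^+ 2 by rewrite expr2 ler_peMr// ltW.
  by move: h1; rewrite ler_pdivrMr// => h1; have := ler_wpM2r (ltW e0) h2; lra.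
have /cvgr0_norm_le/(_ _ (divr_gt0 e0 (ltr0n _ 2))) rs :
  \sum_a \int[P]_w Num.min 1 `|r a n w| @[n --> \oo] --> 0 by exact: cvg0_bigsum.
exists (1 + L); near=> n.
have n0 : (0 < n)%N by near: n; exact: nbhs_infty_gt.
have n0' : 0 < n%:R :> R by rewrite ltr0n.
have mo : measurable ((Y n : T -> vecR R (p * p)) @^-1` outside (1 + L)).
  by rewrite -[Q in measurable Q]setTI; apply: mY => //; exact: outside_measurable.
have mS a : measurable_fun setT (S (e_ a) n).
  apply: measurable_funM => //; apply: measurable_sum => l.
  exact: measurableT_comp (@centered_measurable _ _ F t (e_ a)) (mX l).
have sumL a : L1 P (fun w => (\sum_(l < n) centered F t (e_ a) (X l w)) ^+ 2).
  pose B := \sum_b `|e_ a ord0 b| * 2.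
  have B0 : 0 <= B by apply: sumr_ge0 => b _; rewrite mulr_ge0.
  apply: (@L1_bounded _ _ _ _ _ ((\sum_(l < n) B) ^+ 2)) => [|w].
    apply: measurable_funX; apply: measurable_sum => l.
    exact: measurableT_comp (@centered_measurable _ _ F t (e_ a)) (mX l).
  rewrite normrX lerXn2r ?nnegrE ?sumr_ge0//.
  rewrite (le_trans (ler_norm_sum _ _ _))// ler_sum// => l _.
  exact: centered_le.
have S2E a w : S (e_ a) n w ^+ 2 =
    n%:R^-1 * (\sum_(l < n) centered F t (e_ a) (X l w)) ^+ 2.
  by rewrite /S exprMn exprVn sqr_sqrtr// ltW.
have SL a : L1 P (fun w => S (e_ a) n w ^+ 2).
  by under eq_fun do rewrite S2E; exact: L1Z.
have SE a : \int[P]_w (S (e_ a) n w ^+ 2) = \int[F]_x (centered F t (e_ a) x ^+ 2).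
  under eq_Rintegral do rewrite S2E.
  rewrite IntZ// (iid_sum_sqr iidX n (@centered_measurable _ _ F t (e_ a))
    (@centered_le _ _ F t (e_ a)) (@centered_mean _ _ F t (e_ a))).
  by rewrite mulKf// gt_eqF.
have tL a : L1 P (fun w => (L ^+ 2)^-1 * S (e_ a) n w ^+ 2 + Num.min 1 `|r a n w|).
  by apply: L1D => //; exact: L1Z.
have min0 a w : 0 <= Num.min 1 `|r a n w| by rewrite le_min ler01 normr_ge0.
have t0 a w : 0 <= (L ^+ 2)^-1 * S (e_ a) n w ^+ 2 + Num.min 1 `|r a n w|.
  by rewrite addr_ge0// mulr_ge0 ?sqr_ge0// invr_ge0 sqr_ge0.
rewrite -Int_indic//.
apply: (@le_trans _ _ (\int[P]_w \sum_a ((L ^+ 2)^-1 * S (e_ a) n w ^+ 2 + Num.min 1 `|r a n w|))).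
  apply: Int_le => [||w]; [exact: integrable_indic|exact: L1_sum|].
  rewrite indicE; have [|_] := boolP (w \in _); last by apply: sumr_ge0.
  rewrite inE => -[a]; rewrite YE// => Ka.
  rewrite (bigD1 a)//= -[leLHS]addr0 lerD ?sumr_ge0//.
  have := lt_le_trans Ka (ler_normD _ _) => {}Ka.
  have [ra|ra] := leP 1 `|r a n w|.
    by rewrite lerDr mulr_ge0 ?sqr_ge0// invr_ge0 sqr_ge0.
  rewrite -[leLHS]addr0 lerD//.
  rewrite ler_pdivlMl ?exprn_gt0// mulr1 -[leRHS]real_normK ?num_real//.
  by rewrite lerXn2r ?nnegrE ?(ltW L0)//; lra.
rewrite Int_sum//.
rewrite (eq_bigr (fun a => (L ^+ 2)^-1 * \int[F]_x (centered F t (e_ a) x ^+ 2) +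
    \int[P]_w Num.min 1 `|r a n w|)); last first.
  by move=> a _; rewrite IntD// ?IntZ// ?SE//; exact: L1Z.
rewrite big_split/= -mulr_sumr -/vs mulrC [leRHS]splitr lerD//.
by rewrite (le_trans (ler_norm _))//; near: n.
Unshelve. all: by end_near. Qed.
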